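(* Let $\mathfrak{U}$ be an amenable Banach algebra. Then for each $\phi\in\Delta(\mathfrak{U})$ and each Banach $\mathfrak{U}$-bimodule $X$ such that either $x\cdot a=\phi(a)x$ for all $a\in\mathfrak{U}$, $x\in X$, or $a\cdot x=\phi(a)x$ for all $a\in\mathfrak{U}$, $x\in X$, and for every continuous Lie derivation $\delta:\mathfrak{U}\to X$, there exist a continuous derivation $d:\mathfrak{U}\to X$ and a continuous center-valued trace $\varphi:\mathfrak{U}\to\mathcal{Z}_{\mathfrak{U}}(X)$ such that $\delta=d+\varphi$.
   Context: Banach algebras are complex. $\Delta(\mathfrak{U})$ is the set of all non-zero multiplicative linear functionals on $\mathfrak{U}$. For a Banach $\mathfrak{U}$-bimodule $X$, the dual $X^*$ is a Banach $\mathfrak{U}$-bimodule via $\langle a\cdot f,x\rangle=\langle f,x\cdot a\rangle$ and $\langle f\cdot a,x\rangle=\langle f,a\cdot x\rangle$. A linear map $\delta:\mathfrak{U}\to X$ is a derivation if $\delta(ab)=\delta(a)\cdot b+a\cdot\delta(b)$ for all $a,b\in\mathfrak{U}$; it is inner if for some $x\in X$, $\delta(a)=a\cdot x-x\cdot a$ for all $a$. $\mathfrak{U}$ is amenable if for every Banach $\mathfrak{U}$-bimodule $X$, every continuous derivation $\mathfrak{U}\to X^*$ is inner. The centre of $X$ is $\mathcal{Z}_{\mathfrak{U}}(X)=\{x\in X: a\cdot x=x\cdot a\text{ for all }a\in\mathfrak{U}\}$. A linear map $\delta:\mathfrak{U}\to X$ is a Lie derivation if $\delta([a,b])=[\delta(a),b]+[a,\delta(b)]$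 for all $a,b\in\mathfrak{U}$, where $[a,b]=ab-ba$, $[a,x]=a\cdot x-x\cdot a$ and $[x,a]=x\cdot a-a\cdot x$ for $a,b\in\mathfrak{U}$, $x\in X$. A center-valued trace is a linear map $\varphi:\mathfrak{U}\to\mathcal{Z}_{\mathfrak{U}}(X)$ with $\varphi([a,b])=0$ for all $a,b\in\mathfrak{U}$. *)

(* Defs.v *)
From HB Require Import structures.
From mathcomp Require Import all_boot all_order all_algebra.
From mathcomp Require Import complex ring.
From mathcomp Require Import all_classical all_reals all_analysis.

Set Implicit Arguments.
Unset Strict Implicit.
Unset Printing Implicit Defensive.

Import Order.TTheory GRing.Theory Num.Theory.
Import numFieldNormedType.Exports.

Local Open Scope classical_set_scope.
Local Open Scope ring_scope.

Reserved Notation "a ** b" (at level 40, left associativity).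
Reserved Notation "a *> x" (at level 40, left associativity).
Reserved Notation "x <* a" (at level 40, left associativity).

(* Banach algebras are not assumed to be unital, so the product cannot be the
   multiplication of a MathComp ring structure, which always has a unit. *)
HB.mixin Record isBanachAlgebra (R : realType) A
    & CompleteNormedModule R[i] A := {
  bmul : A -> A -> A ;
  bmulA : forall a b c, bmul a (bmul b c) = bmul (bmul a b) c ;
  bmulDl : forall a b c, bmul (a + b) c = bmul a c + bmul b c ;
  bmulDr : forall a b c, bmul a (b + c) = bmul a b + bmul a c ;
  bmulZl : forall (k : R[i]) a b, bmul (k *: a) b = k *: bmul a b ;
  bmulZr : forall (k : R[i]) a b, bmul a (k *: b) = k *: bmul a b ;
  ler_bmul : forall a b, `|bmul a b| <= `|a| * `|b|
}.

#[short(type="banachAlgType")]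
HB.structure Definition BanachAlgebra (R : realType) :=
  {A of CompleteNormedModule R[i] A & isBanachAlgebra R A}.

Notation "a ** b" := (bmul a b) : ring_scope.

HB.mixin Record isBanachBimodule (R : realType) (A : banachAlgType R) X
    & CompleteNormedModule R[i] X := {
  lact : A -> X -> X ;
  ract : X -> A -> X ;
  lactDl : forall a b x, lact (a + b) x = lact a x + lact b x ;
  lactDr : forall a x y, lact a (x + y) = lact a x + lact a y ;
  lactZl : forall (k : R[i]) a x, lact (k *: a) x = k *: lact a x ;
  lactZr : forall (k : R[i]) a x, lact a (k *: x) = k *: lact a x ;
  ractDl : forall x y a, ract (x + y) a = ract x a + ract y a ;
  ractDr : forall x a b, ract x (a + b) = ract x a + ract x b ;
  ractZl : forall (k : R[i]) x a, ract (k *: x) a = k *: ract x a ;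
  ractZr : forall (k : R[i]) x a, ract x (k *: a) = k *: ract x a ;
  lactA : forall a b x, lact a (lact b x) = lact (bmul a b) x ;
  ractA : forall x a b, ract (ract x a) b = ract x (bmul a b) ;
  lractA : forall a x b, lact a (ract x b) = ract (lact a x) b ;
  lact_bounded :
    exists M : R[i], forall a x, `|lact a x| <= M * `|a| * `|x| ;
  ract_bounded :
    exists M : R[i], forall x a, `|ract x a| <= M * `|x| * `|a|
}.

#[short(type="banachBimodType")]
HB.structure Definition BanachBimodule (R : realType) (A : banachAlgType R) :=
  {X of CompleteNormedModule R[i] X & isBanachBimodule R A X}.

Notation "a *> x" := (lact a x) : ring_scope.
Notation "x <* a" := (ract x a) : ring_scope.

Section derivations.
Context {R : realType} {A : banachAlgType R} {X : banachBimodType A}.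
Implicit Types (a b : A) (x : X) (delta phi : {linear A -> X}).

Definition derivation delta :=
  forall a b, delta (a ** b) = delta a <* b + a *> delta b.

Definition inner delta :=
  exists x, forall a, delta a = a *> x - x <* a.

Definition center : set X := [set x | forall a, a *> x = x <* a].

Definition commAA a b : A := a ** b - b ** a.
Definition commAX a x : X := a *> x - x <* a.
Definition commXA x a : X := x <* a - a *> x.

Definition lie_derivation delta :=
  forall a b, delta (commAA a b) = commXA (delta a) b + commAX a (delta b).

Definition center_valued_trace phi :=
  (forall a, center (phi a)) /\ (forall a b, phi (commAA a b) = 0).

End derivations.

Definition character (R : realType) (A : banachAlgType R)
    (phi : {linear A -> R[i]^o}) :=
  (exists a, phi a != 0) /\ (forall a b, phi (a ** b) = phi a * phi b).

Section complex_complete.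
Variable R : realType.
Local Notation C := R[i].

Lemma complex_normE (z : C) :
  complex.Re `|z| = Num.sqrt (complex.Re z ^+ 2 + complex.Im z ^+ 2).
Proof. by case: z. Qed.

Lemma complex_normRe (z : C) : `|z| = (complex.Re `|z|)%:C%C.
Proof. by case: z. Qed.

Lemma Re_ge0 (z : C) : 0 <= z -> 0 <= complex.Re z.
Proof. by rewrite lecE => /andP[_]. Qed.

Lemma Re_le (z w : C) : z <= w -> complex.Re z <= complex.Re w.
Proof. by rewrite lecE => /andP[_]. Qed.

Lemma normRe_le (z : C) : `|complex.Re z| <= complex.Re `|z|.
Proof.
rewrite complex_normE -sqrtr_sqr ler_sqrt ?addr_ge0 ?sqr_ge0//.
by rewrite lerDl sqr_ge0.
Qed.

Lemma normIm_le (z : C) : `|complex.Im z| <= complex.Re `|z|.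
Proof.
rewrite complex_normE -sqrtr_sqr ler_sqrt ?addr_ge0 ?sqr_ge0//.
by rewrite lerDr sqr_ge0.
Qed.

Lemma norm_le_ReIm (z : C) :
  `|z| <= (`|complex.Re z| + `|complex.Im z|)%:C%C.
Proof.
rewrite complex_normRe lecR complex_normE.
rewrite -[leRHS]ger0_norm ?addr_ge0// -sqrtr_sqr ler_sqrt ?sqr_ge0//.
rewrite sqrrD !real_normK ?num_real// lerD2r lerDl.
by rewrite mulrn_wge0// mulr_ge0.
Qed.

Lemma complex_complete (F : set_system C^o) :
  ProperFilter F -> cauchy F -> cvg F.
Proof.
move=> FF /cauchyP F_cauchy.
have part (p : C^o -> R) : (forall z w, p (z - w) = p z - p w) ->
    (forall z : C, `|p z| <= complex.Re `|z|) -> cvg (p @ F).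
  move=> pB pn; apply: R_complete; apply/cauchyP => e e0.
  have [|z Fz] := F_cauchy e%:C%C; first by rewrite ltcR.
  exists (p z); change (F (p @^-1` ball (p z) e)).
  apply: filterS Fz => w; rewrite -!ball_normE/= => zw.
  have := pn (z - w); rewrite pB => /le_lt_trans; apply.
  by rewrite -ltcR -complex_normRe.
have Re_cvg : cvg ((@complex.Re R : C^o -> R) @ F).
  by apply: part; [case=> ? ? [] | exact: normRe_le].
have Im_cvg : cvg ((@complex.Im R : C^o -> R) @ F).
  by apply: part; [case=> ? ? [] | exact: normIm_le].
have /cvg_ex[x /cvgrPdist_lt Fx] := Re_cvg.
have /cvg_ex[y /cvgrPdist_lt Fy] := Im_cvg.
apply/cvg_ex; exists (Complex x y : C^o); apply/cvgrPdist_lt => e e0.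
have [eIm eRe] : complex.Im e = 0 /\ 0 < complex.Re e.
  by move: e0; rewrite ltcE => /andP[/eqP].
have eE : e = (complex.Re e)%:C%C by case: (e) eIm => ? ? /= ->.
have e2 : 0 < complex.Re e / 2 by rewrite divr_gt0.
near=> z.
rewrite (le_lt_trans (norm_le_ReIm _))// eE ltcR [ltRHS]splitr ltrD//.
- by near: z; have := Fx _ e2; apply: filterS; case.
- by near: z; have := Fy _ e2; apply: filterS; case.
Unshelve. all: by end_near. Qed.
End complex_complete.

Section dual_space.
Context {R : realType}.
Local Notation C := R[i].

Definition dual_pred (X : normedModType C) : {pred X -> C^o} :=
  fun f => `[< linear f /\ continuous f >].

Record dual (X : normedModType C) := Dual {
  dual_fun :> X -> C^o ;
  dual_funP : dual_fun \in @dual_pred X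
}.

Variable X : normedModType C.
Implicit Types f g : dual X.

HB.instance Definition _ := [isSub for @dual_fun X].
HB.instance Definition _ := [Choice of dual X by <:].

Lemma dual_predP (f : X -> C^o) :
  f \in @dual_pred X <->
  linear f /\ exists2 M : C, 0 <= M & forall x, `|f x| <= M * `|x|.
Proof.
split=> [/asboolP[lf cf]|[lf [M M0 fM]]].
  split=> //.
  pose F : {linear X -> C^o} := HB.pack f (GRing.isLinear.Build _ _ _ _ f lf).
  have /linear_bounded_continuous/linear_boundedP : continuous F by exact: cf.
  by move=> /pinfty_ex_gt0[M M0 fM]; exists M; rewrite ?ltW.
apply/asboolP; split=> //.
pose F : {linear X -> C^o} := HB.pack f (GRing.isLinear.Build _ _ _ _ f lf).
suff : continuous F by [].
apply/linear_bounded_continuous/linear_boundedP.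
exists M; split=> [|r Mr x]; first exact: ger0_real.
by rewrite (le_trans (fM x))// ler_wpM2r// ltW.
Qed.

Lemma dual_submod_closed : submod_closed (@dual_pred X).
Proof.
split=> [|k f g /dual_predP[lf [M M0 fM]] /dual_predP[lg [N N0 gN]]].
  apply/dual_predP; split=> [k x y|]; first by rewrite scaler0 addr0.
  by exists 0 => // x; rewrite normr0 mul0r.
apply/dual_predP; split=> [l x y|].
  rewrite !fctE lf lg !scalerDr !scalerA (mulrC k l) -!addrA.
  by congr (_ + _); rewrite addrCA.
exists (`|k| * M + N) => [|x]; first by rewrite addr_ge0// mulr_ge0.
rewrite (le_trans (ler_normD _ _))// mulrDl lerD//.
by rewrite normrZ -mulrA ler_wpM2l.
Qed.

HB.instance Definition _ :=
  GRing.isSubmodClosed.Build C (X -> C^o) (@dual_pred X) dual_submod_closed.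
HB.instance Definition _ := [SubChoice_isSubLmodule of dual X by <:].

Lemma dual_linear f : linear f.
Proof. by have /dual_predP[] := dual_funP f. Qed.

HB.instance Definition _ f :=
  GRing.isLinear.Build C X C^o *:%R (dual_fun f) (dual_linear f).

Lemma dual_continuous f : continuous f.
Proof. by have /asboolP[] := dual_funP f. Qed.

Lemma dual_ext f g : f =1 g -> f = g.
Proof. by move=> fg; apply/val_inj/funext. Qed.

Lemma dual_addE f g x : (f + g) x = f x + g x. Proof. by []. Qed.
Lemma dual_oppE f x : (- f) x = - f x. Proof. by []. Qed.
Lemma dual_zeroE x : (0 : dual X) x = 0. Proof. by []. Qed.
Lemma dual_scaleE (k : C) f x : (k *: f) x = k *: f x. Proof. by []. Qed.

(* Norms over R[i] take values in R[i], which has no suprema; the operator norm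
   is computed in R and injected back. *)
Definition dual_norm f : C :=
  (sup [set complex.Re `|f x| | x in [set x : X | `|x| <= 1]])%:C%C.

Let unit_values f := [set complex.Re `|f x| | x in [set x : X | `|x| <= 1]].

Let unit_values0 f : unit_values f !=set0.
Proof. by exists (complex.Re `|f 0|); exists 0; rewrite //= normr0. Qed.

Let unit_values_bounded f M : 0 <= M -> (forall x, `|f x| <= M * `|x|) ->
  ubound (unit_values f) (complex.Re M).
Proof.
move=> M0 fM _ [x x1 <-]; apply: Re_le.
by rewrite (le_trans (fM x))// ler_piMr.
Qed.

Let unit_values_sup f : has_sup (unit_values f).
Proof.
split; first exact: unit_values0.
have /dual_predP[_ [M M0 fM]] := dual_funP f.
by exists (complex.Re M); exact: unit_values_bounded.
Qed.

Lemma dual_norm_ge0 f : 0 <= dual_norm f.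
Proof.
rewrite ler0c (@le_trans _ _ (complex.Re `|f 0|))//; first exact: Re_ge0.
apply: ub_le_sup; first exact: (unit_values_sup f).2.
by exists 0; rewrite //= normr0.
Qed.

Lemma dual_norm_le f M : 0 <= M -> (forall x, `|f x| <= M * `|x|) ->
  dual_norm f <= M.
Proof.
move=> M0 fM; have -> : M = (complex.Re M)%:C%C.
  by rewrite -(ger0_norm M0) -complex_normRe.
rewrite lecR; apply: ge_sup; first exact: unit_values0.
exact: unit_values_bounded.
Qed.

Lemma ler_dual_norm f x : `|f x| <= dual_norm f * `|x|.
Proof.
have [->|x0] := eqVneq x 0; first by rewrite raddf0 !normr0 mulr0.
have nx0 : 0 < `|x| by rewrite normr_gt0.
rewrite -ler_pdivrMr// mulrC.
have -> : `|x|^-1 * `|f x| = `|f (`|x|^-1 *: x)|.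
  by rewrite linearZ normrZ ger0_norm// invr_ge0.
rewrite complex_normRe lecR; apply: ub_le_sup.
  exact: (unit_values_sup f).2.
by exists (`|x|^-1 *: x); rewrite //= normrZ ger0_norm ?invr_ge0// mulVf ?gt_eqF.
Qed.

Lemma ler_dual_normD f g : dual_norm (f + g) <= dual_norm f + dual_norm g.
Proof.
apply: dual_norm_le => [|x]; first by rewrite addr_ge0 ?dual_norm_ge0.
by rewrite mulrDl (le_trans (ler_normD _ _))// lerD// ler_dual_norm.
Qed.

Let dual_normZ_le (k : C) f : dual_norm (k *: f) <= `|k| * dual_norm f.
Proof.
apply: dual_norm_le => [|x]; first by rewrite mulr_ge0 ?dual_norm_ge0.
by rewrite dual_scaleE normrZ -mulrA ler_wpM2l// ler_dual_norm.
Qed.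

Lemma dual_normZ (k : C) f : dual_norm (k *: f) = `|k| * dual_norm f.
Proof.
apply/eqP; rewrite eq_le dual_normZ_le/=.
have [->|k0] := eqVneq k 0; first by rewrite normr0 mul0r dual_norm_ge0.
rewrite -ler_pdivlMl ?normr_gt0// -normfV (le_trans _ (dual_normZ_le _ _))//.
by rewrite scalerA mulVf// scale1r.
Qed.

Lemma dual_norm0_eq0 f : dual_norm f = 0 -> f = 0.
Proof.
move=> f0; apply: dual_ext => x; apply/eqP; rewrite -normr_le0.
by rewrite (le_trans (ler_dual_norm f x))// f0 mul0r.
Qed.

HB.instance Definition _ := Lmodule_isNormed.Build C (dual X)
  ler_dual_normD dual_normZ dual_norm0_eq0.

Lemma ler_dual f x : `|f x| <= `|f| * `|x|.
Proof. exact: ler_dual_norm. Qed.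

Lemma dual_complete (F : set_system (dual X)) :
  ProperFilter F -> cauchy F -> cvg F.
Proof.
move=> FF Fc; have /cauchyP Fex := Fc.
have Fx x : cvg ((fun f : dual X => f x : C^o) @ F).
  apply: complex_complete; apply/cauchyP => e e0.
  have x1 : 0 < `|x| + 1 by rewrite ltr_wpDl.
  have [|f Ff] := Fex (e / (`|x| + 1)); first by rewrite divr_gt0.
  exists (f x).
  change (F ((fun g : dual X => g x : C^o) @^-1` ball (f x : C^o) e)).
  apply: filterS Ff => g; rewrite -!ball_normE/= => fg.
  have := ler_dual (f - g) x => /le_lt_trans; apply.
  rewrite (@le_lt_trans _ _ (`|f - g| * (`|x| + 1)))//.
    by rewrite ler_wpM2l// lerDl.
  by rewrite -ltr_pdivlMr.
pose g x : C^o := lim ((fun f : dual X => f x : C^o) @ F).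
have approx e : 0 < e -> \forall f \near F,
    forall x, `|(f : dual X) x - g x| <= e * `|x|.
  move=> e0; have e2 : 0 < e / 2 by rewrite divr_gt0.
  have [f0 Ff0] := Fex _ e2.
  apply: filterS (Ff0) => f; rewrite -ball_normE/= => f0f x.
  apply/ler_addgt0Pr => d d0.
  have [h [Fh hg]] : exists h : dual X, ball f0 (e / 2) h /\ `|g x - h x| < d.
    apply: (@filter_ex _ F); apply: filterI => //.
    by have /cvgrPdist_lt/(_ _ d0) := Fx x.
  move: Fh; rewrite -ball_normE/= => f0h.
  have -> : f x - g x = (f - h) x + - (g x - h x).
    by rewrite dual_addE dual_oppE opprB addrA subrK.
  rewrite (le_trans (ler_normD _ _))// lerD ?normrN ?(ltW hg)//.
  rewrite (le_trans (ler_dual _ _))// ler_wpM2r//.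
  have -> : f - h = (f0 - h) - (f0 - f) by rewrite [RHS]addrC opprB addrA subrK.
  by rewrite (le_trans (ler_normB _ _))// [leRHS]splitr lerD// ltW.
have alg (k a b c d u : C) :
    u - (k * c + d) = - (k * a + b - u) + k * (a - c) + (b - d) by ring.
have gP : g \in @dual_pred X.
  apply/dual_predP; split=> [k x y|].
    apply/eqP; rewrite -subr_eq0 -normr_le0.
    set B := `|k *: x + y| + `|k| * `|x| + `|y|.
    have B0 : 0 <= B by rewrite !addr_ge0// mulr_ge0.
    apply/ler_addgt0Pr => d d0.
    have B1 : 0 < B + 1 by rewrite ltr_wpDl.
    have [f fg] := filter_ex (approx (d / (B + 1)) (divr_gt0 d0 B1)).
    rewrite add0r.
    have -> : g (k *: x + y) - (k *: g x + g y) =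
        - (f (k *: x + y) - g (k *: x + y)) + k *: (f x - g x) + (f y - g y).
      by rewrite (dual_linear f k x y); exact: alg.
    rewrite (@le_trans _ _ (d / (B + 1) * B))//.
      rewrite (le_trans (ler_normD _ _))// /B [leRHS]mulrDr lerD//.
      rewrite (le_trans (ler_normD _ _))// mulrDr lerD ?normrN//.
      by rewrite normrZ mulrCA ler_wpM2l.
    by rewrite mulrAC ler_pdivrMr// ler_pM2l// lerDl.
  have [f fg] := filter_ex (approx 1 ltr01).
  exists (1 + `|f|) => [|x]; first by rewrite addr_ge0.
  have -> : g x = - (f x - g x) + f x by rewrite opprB subrK.
  rewrite (le_trans (ler_normD _ _))// mulrDl normrN lerD//.
  exact: ler_dual.
apply/cvg_ex; exists (Dual gP); apply/cvgrPdist_le => e e0.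
apply: filterS (approx _ e0) => f fg.
apply: dual_norm_le => [|x]; first exact: ltW.
by rewrite dual_addE dual_oppE distrC.
Qed.

HB.instance Definition _ := Uniform_isComplete.Build (dual X) dual_complete.

End dual_space.

Section dual_bimodule.
Context {R : realType} {A : banachAlgType R} {X : banachBimodType A}.
Local Notation C := R[i].
Implicit Types (a b : A) (x y : X) (f g : dual X).

Lemma lact_boundedP :
  exists2 M : C, 0 <= M & forall a x, `|a *> x| <= M * `|a| * `|x|.
Proof.
have [M HM] := @lact_bounded R A X; exists `|M| => // a x.
have -> : `|M| * `|a| * `|x| = `|M * `|a| * `|x| |.
  by rewrite !normrM !normr_id.
by rewrite ger0_norm// (le_trans _ (HM a x)).
Qed.

Lemma ract_boundedP :
  exists2 M : C, 0 <= M & forall x a, `|x <* a| <= M * `|x| * `|a|.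
Proof.
have [M HM] := @ract_bounded R A X; exists `|M| => // x a.
have -> : `|M| * `|x| * `|a| = `|M * `|x| * `|a| |.
  by rewrite !normrM !normr_id.
by rewrite ger0_norm// (le_trans _ (HM x a)).
Qed.

Lemma dual_lact_subproof a f : (fun x => f (x <* a)) \in @dual_pred R X.
Proof.
have [M M0 XM] := ract_boundedP; apply/dual_predP; split=> [k x y|].
  by rewrite ractDl ractZl linearP.
exists (`|f| * (M * `|a|)) => [|x]; first by rewrite !mulr_ge0.
by rewrite (le_trans (ler_dual _ _))// -mulrA ler_wpM2l// mulrAC.
Qed.

Lemma dual_ract_subproof f a : (fun x => f (a *> x)) \in @dual_pred R X.
Proof.
have [M M0 XM] := lact_boundedP; apply/dual_predP; split=> [k x y|].
  by rewrite lactDr lactZr linearP.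
exists (`|f| * (M * `|a|)) => [|x]; first by rewrite !mulr_ge0.
by rewrite (le_trans (ler_dual _ _))// -mulrA ler_wpM2l.
Qed.

Definition dual_lact a f : dual X := Dual (dual_lact_subproof a f).
Definition dual_ract f a : dual X := Dual (dual_ract_subproof f a).

Let dual_lactDl a b f : dual_lact (a + b) f = dual_lact a f + dual_lact b f.
Proof. by apply: dual_ext => x; rewrite /= ractDr raddfD. Qed.

Let dual_lactDr a f g : dual_lact a (f + g) = dual_lact a f + dual_lact a g.
Proof. exact: dual_ext. Qed.

Let dual_lactZl (k : C) a f : dual_lact (k *: a) f = k *: dual_lact a f.
Proof. by apply: dual_ext => x; rewrite /= ractZr linearZ. Qed.

Let dual_lactZr (k : C) a f : dual_lact a (k *: f) = k *: dual_lact a f.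
Proof. exact: dual_ext. Qed.

Let dual_ractDl f g a : dual_ract (f + g) a = dual_ract f a + dual_ract g a.
Proof. exact: dual_ext. Qed.

Let dual_ractDr f a b : dual_ract f (a + b) = dual_ract f a + dual_ract f b.
Proof. by apply: dual_ext => x; rewrite /= lactDl raddfD. Qed.

Let dual_ractZl (k : C) f a : dual_ract (k *: f) a = k *: dual_ract f a.
Proof. exact: dual_ext. Qed.

Let dual_ractZr (k : C) f a : dual_ract f (k *: a) = k *: dual_ract f a.
Proof. by apply: dual_ext => x; rewrite /= lactZl linearZ. Qed.

Let dual_lactA a b f : dual_lact a (dual_lact b f) = dual_lact (a ** b) f.
Proof. by apply: dual_ext => x; rewrite /= ractA. Qed.

Let dual_ractA f a b : dual_ract (dual_ract f a) b = dual_ract f (a ** b).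
Proof. by apply: dual_ext => x; rewrite /= lactA. Qed.

Let dual_lractA a f b :
  dual_lact a (dual_ract f b) = dual_ract (dual_lact a f) b.
Proof. by apply: dual_ext => x; rewrite /= lractA. Qed.

Let dual_lact_bounded :
  exists M : C, forall a f, `|dual_lact a f| <= M * `|a| * `|f|.
Proof.
have [M M0 XM] := ract_boundedP; exists M => a f.
apply: dual_norm_le => [|x]; first by rewrite !mulr_ge0.
apply: le_trans (ler_dual f (x <* a)) _.
by rewrite [leRHS]mulrAC mulrC ler_wpM2r// mulrAC.
Qed.

Let dual_ract_bounded :
  exists M : C, forall f a, `|dual_ract f a| <= M * `|f| * `|a|.
Proof.
have [M M0 XM] := lact_boundedP; exists M => f a.
apply: dual_norm_le => [|x]; first by rewrite !mulr_ge0.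
apply: le_trans (ler_dual f (a *> x)) _.
by rewrite -!mulrA (mulrCA M) ler_wpM2l// mulrA.
Qed.

HB.instance Definition _ := isBanachBimodule.Build R A (dual X)
  dual_lactDl dual_lactDr dual_lactZl dual_lactZr
  dual_ractDl dual_ractDr dual_ractZl dual_ractZr
  dual_lactA dual_ractA dual_lractA dual_lact_bounded dual_ract_bounded.

Lemma dual_lactE a f x : (a *> f) x = f (x <* a). Proof. by []. Qed.

Lemma dual_ractE f a x : (f <* a) x = f (a *> x). Proof. by []. Qed.

End dual_bimodule.

Definition amenable (R : realType) (A : banachAlgType R) :=
  forall (X : banachBimodType A) (D : {linear A -> dual X}),
    continuous D -> derivation D -> inner D.

(* Main.v *)
(* Suppose [x <* a = phi a *: x]; the other case is this one over the opposite
   algebra. Amenability, applied to bimodules carried by [U] itself, gives the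
   ideal [I = ker phi] a two-sided unit [E] in the bidual, which plays the role
   of a bounded approximate unit. Testing the Lie identity for [[a, x]] against
   [E] in [x] gives [c *> delta (a ** b) = c *> (a *> delta b)] on [I]. Hence the
   weak limit [dI a] of [x *> delta a] along [E] is [a' *> delta b] at
   [a = a' ** b]; products are dense in [I] and [X] is complete, so [dI] is a
   bounded map from [I] to [X]. It extends to a derivation [d] of [U], by
   prescribing [d e] for some [e] with [phi e = 1], and [delta - d] is central.
   Being the difference of two Lie derivations, it vanishes on commutators.
   Passing from the biduals back to [X] uses the Hahn-Banach theorem. *)
From HB Require Import structures.
Require Import Defs.
From mathcomp Require Import all_boot all_order all_algebra.
From mathcomp Require Import complex.
From mathcomp Require Import all_classical all_reals all_analysis.
From mathcomp Require Import ring lra.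

Set Implicit Arguments.
Unset Strict Implicit.
Unset Printing Implicit Defensive.

Import Order.TTheory GRing.Theory Num.Theory.
Import numFieldNormedType.Exports.

Local Open Scope classical_set_scope.
Local Open Scope ring_scope.

(** * The Hahn-Banach theorem, for real sublinear functionals and for complex seminorms *)

Section hahn_banach.
Context {R : realType} {V : lmodType R[i]}.
Implicit Types (p q : V -> R) (x y : V).

Definition sublinear q :=
  (forall x y, q (x + y) <= q x + q y) /\
  (forall (r : R) x, 0 <= r -> q (r%:C%C *: x) <= r * q x).

Lemma sublinear0 q : sublinear q -> q 0 = 0.
Proof.
move=> [qD qZ]; apply/eqP; rewrite eq_le.
have := qZ 0 0 (lexx 0); rewrite scaler0 mul0r => -> /=.
by have := qD 0 0; rewrite addr0 lerDl.
Qed.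

Lemma sublinearZ q (r : R) x : sublinear q -> 0 <= r ->
  q (r%:C%C *: x) = r * q x.
Proof.
move=> qs r0; have [_ qZ] := qs.
have [->|rN0] := eqVneq r 0; first by rewrite mul0r scale0r sublinear0.
have rpos : 0 < r by rewrite lt_neqAle eq_sym rN0.
apply/eqP; rewrite eq_le qZ //=.
have r'0 : 0 <= r^-1 by rewrite invr_ge0.
have := qZ r^-1 (r%:C%C *: x) r'0.
rewrite scalerA -rmorphM mulVf //= scale1r.
by rewrite mulrC ler_pdivlMr // mulrC.
Qed.

Lemma sublinearN q x : sublinear q -> - q (- x) <= q x.
Proof.
move=> qs; have := (qs.1 (- x) x); rewrite addNr (sublinear0 qs).
by move=> ?; lra.
Qed.

(** Lowers a sublinear [q] in the direction [- y]: the result is still sublinear and below [q], and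
    [t = 1] shows that its value at [- y] is at most [- q y]. *)
Definition tilt q y x : R :=
  inf [set q (x + t%:C%C *: y) - t * q y | t in [set t : R | 0 <= t]].

Let tilt_set q y x :=
  [set q (x + t%:C%C *: y) - t * q y | t in [set t : R | 0 <= t]].

Let tilt_has_lbound q y x : sublinear q -> has_lbound (tilt_set q y x).
Proof.
move=> qs; exists (- q (- x)) => _ [t /= t0 <-].
have := qs.1 (x + t%:C%C *: y) (- x).
rewrite addrAC subrr add0r sublinearZ // => ?; lra.
Qed.

Lemma tilt_le q y x (t : R) : sublinear q -> 0 <= t ->
  tilt q y x <= q (x + t%:C%C *: y) - t * q y.
Proof. by move=> qs t0; apply: ge_inf; [exact: tilt_has_lbound|exists t]. Qed.

Lemma tilt_le_id q y x : sublinear q -> tilt q y x <= q x.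
Proof.
move=> qs; have := tilt_le y x qs (lexx 0).
by rewrite scale0r addr0 mul0r subr0.
Qed.

Lemma le_tilt q y x (c : R) :
  (forall t : R, 0 <= t -> c <= q (x + t%:C%C *: y) - t * q y) ->
  c <= tilt q y x.
Proof.
move=> qc; apply: lb_le_inf; first 
  by exists (q (x + 0%:C%C *: y) - 0 * q y), 0 => /=.
by move=> _ [t t0 <-]; exact: qc.
Qed.

Lemma sublinear_tilt q y : sublinear q -> sublinear (tilt q y).
Proof.
move=> qs; split=> [x x'|r x r0].
  rewrite -lerBlDr; apply: le_tilt => s s0; rewrite lerBlDr -lerBlDl.
  apply: le_tilt => t t0; rewrite lerBlDl.
  apply: (le_trans (tilt_le y _ qs (addr_ge0 s0 t0))).
  have := qs.1 (x + s%:C%C *: y) (x' + t%:C%C *: y).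
  by rewrite addrACA -scalerDl -rmorphD mulrDl => ?; lra.
have [->|rN0] := eqVneq r 0.
  by rewrite scale0r mul0r (le_trans (tilt_le_id _ _ _))// sublinear0.
have rpos : 0 < r by rewrite lt_neqAle eq_sym rN0.
rewrite -ler_pdivrMl //; apply: le_tilt => t t0; rewrite ler_pdivrMl //.
apply: (le_trans (tilt_le y _ qs (mulr_ge0 r0 t0))).
by rewrite rmorphM -scalerA -scalerDr sublinearZ // mulrBr mulrA.
Qed.

(** Zorn's lemma for the reversed pointwise order. A chain is bounded by its pointwise infimum,
    which is finite because every member is at least [- p (- x)] at [x], and subadditive because of
    two members the smaller one can be used at both points. *)
Lemma minimal_sublinear p : sublinear p ->
  exists q, [/\ sublinear q, forall x, q x <= p x &
    forall q', sublinear q' -> (forall x, q' x <= q x) ->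
      forall x, q x <= q' x].
Proof.
move=> ps.
pose T := {q | sublinear q /\ forall x, q x <= p x}.
pose t0 : T := exist _ p (conj ps (fun x => lexx (p x))).
pose Q (s t : T) := `[< forall x, sval t x <= sval s x >].
have [||A totA|[q [qs qp]] qmax] := @ZL_preorder T t0 Q.
- by move=> t; apply/asboolP.
- move=> r s t /asboolP rs /asboolP st; apply/asboolP => x.
  exact: le_trans (st x) (rs x).
- have [A0|/set0P[a Aa]] := eqVneq A set0.
    by exists t0 => s; rewrite A0.
  pose S x := [set sval t x | t in A].
  have S0 x : S x !=set0 by exists (sval a x), a.
  have Slb x : has_lbound (S x).
    exists (- p (- x)) => _ [[t [ts tp]] At <-] /=.
    by rewrite (le_trans _ (sublinearN x ts))// lerN2.
  have infS t x : A t -> inf (S x) <= sval t x.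
    by move=> At; apply: ge_inf => //; exists t.
  have infs : sublinear (fun x => inf (S x)).
    split=> [x y|r x r0].
      rewrite -lerBlDr; apply: lb_le_inf => // _ [s As <-].
      rewrite lerBlDr -lerBlDl.
      apply: lb_le_inf => // _ [t At <-]; rewrite lerBlDl.
      have [/asboolP st|/asboolP ts] := totA _ _ As At.
        rewrite (le_trans (infS t _ At))// (le_trans ((svalP t).1.1 x y))//.
        by rewrite lerD2r; have := st x; rewrite /=.
      rewrite (le_trans (infS s _ As))// (le_trans ((svalP s).1.1 x y))//.
      by rewrite lerD2l; have := ts y; rewrite /=.
    have [->|rN0] := eqVneq r 0.
      rewrite scale0r mul0r (le_trans (infS _ _ Aa))//.
      by rewrite (sublinear0 (svalP a).1).
    have rpos : 0 < r by rewrite lt_neqAle eq_sym rN0.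
    rewrite -ler_pdivrMl //; apply: lb_le_inf => // _ [s As <-].
    by rewrite ler_pdivrMl// (le_trans (infS _ _ As))// ((svalP s).1.2 r x).
  have infp x : inf (S x) <= p x.
    by rewrite (le_trans (infS _ _ Aa))//; exact: (svalP a).2.
  exists (exist _ (fun x => inf (S x)) (conj infs infp)) => s As.
  by apply/asboolP => x /=; exact: infS.
exists q; split=> // q' q's q'q.
have q'p x : q' x <= p x by exact: le_trans (q'q x) (qp x).
have /(_ _)/asboolP := qmax (exist _ q' (conj q's q'p)).
by apply; apply/asboolP.
Qed.

(* A minimal sublinear functional is additive, because it coincides with its
   tilts. *)
Lemma hahn_banach_sublinear p x0 : sublinear p ->
  exists u : V -> R, [/\ forall x y, u (x + y) = u x + u y,
    forall (r : R) x, u (r%:C%C *: x) = r * u x,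
    forall x, u x <= p x & u x0 = p x0].
Proof.
move=> ps.
(* Starting below [tilt p x0] instead of [p] forces [u (- x0) <= - p x0], which yields [u x0 = p x0]
   at the end. *)
have [u [us up umin]] := minimal_sublinear (sublinear_tilt x0 ps).
have uD x y : u (x + y) = u x + u y.
  apply/eqP; rewrite eq_le us.1 /=.
  have /(_ (x))ux := umin _ (sublinear_tilt y us) (fun x => tilt_le_id y x us).
  have := le_trans ux (tilt_le y x us ler01).
  by rewrite scale1r mul1r lerBrDr.
have uN x : u (- x) = - u x.
  by apply/eqP; rewrite -addr_eq0 -uD addNr (sublinear0 us).
have u_le x : u x <= p x by exact: le_trans (up x) (tilt_le_id _ _ ps).
exists u; split=> //.
  move=> r x; have [r0|/ltW r0] := leP 0 r; first exact: sublinearZ.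
  rewrite -(opprK r) rmorphN scaleNr uN sublinearZ ?mulNr// oppr_ge0 //.
apply/eqP; rewrite eq_le u_le /= -(opprK x0) uN opprK.
have := le_trans (up (- x0)) (tilt_le x0 (- x0) ps ler01).
by rewrite scale1r mul1r addNr sublinear0 // add0r => ?; rewrite lerNr.
Qed.

Theorem hahn_banach_seminorm p x0 :
  (forall x y, p (x + y) <= p x + p y) ->
  (forall (k : R[i]) x, p (k *: x) = complex.Re `|k| * p x) ->
  exists f : V -> R[i]^o, [/\ linear f,
    forall x, `|f x| <= (p x)%:C%C & complex.Re (f x0) = p x0].
Proof.
move=> pD pZ.
have ReC (r : R) : 0 <= r -> complex.Re `|r%:C%C| = r.
  by move=> r0; rewrite ger0_norm// ler0c.
have ps : sublinear p.
  by split=> [//|r x r0]; rewrite pZ ReC.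
have p_ge0 x : 0 <= p x.
  have := pD x (- x); rewrite subrr (sublinear0 ps) -scaleN1r pZ normrN1 /=.
  by move=> ?; lra.
have [u [uD uZ up ux0]] := hahn_banach_sublinear x0 ps.
(* The only complex-linear functional whose real part is [u]. *)
pose f x : R[i]^o := Complex (u x) (- u ('i%C *: x)).
have fD x y : f (x + y) = f x + f y.
  by rewrite /f scalerDr !uD opprD.
have uCZ a b x : u (Complex a b *: x) = a * u x + b * u ('i%C *: x).
  rewrite -!uZ -uD; congr u; rewrite scalerA -scalerDl; congr (_ *: _).
  by apply/eqP; rewrite eq_complex /=; apply/andP; split; apply/eqP; ring.
have fZ k x : f (k *: x) = k *: f x.
  case: k => a b; rewrite /f scalerA uCZ.
  have -> : 'i%C * Complex a b = Complex (- b) a.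
    by apply/eqP; rewrite eq_complex /=; apply/andP; split; apply/eqP; ring.
  rewrite (uCZ (- b)); apply/eqP; rewrite eq_complex /=.
  by apply/andP; split; apply/eqP; ring.
exists f; split=> [k x y|x|//]; first by rewrite fD fZ.
set z := f x; have nz := complex_normRe z.
rewrite nz lecR.
have [Re0|Re0] := eqVneq (complex.Re `|z|) 0; first by rewrite Re0.
have Re_gt0 : 0 < complex.Re `|z| by rewrite lt_neqAle eq_sym Re0 Re_ge0.
(* Rotate by the conjugate of [z = f x]: the value of [f] at [z^*%C *: x] is the real number
   [|z|^2], hence a value of [u], and [p] there is [|z|] times [p x]. *)
rewrite -(ler_pM2l Re_gt0).
have <- : complex.Re `|z^*%C| = complex.Re `|z| by rewrite normcJ.
rewrite -pZ (le_trans _ (up _))//.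
have -> : u (z^*%C *: x) = complex.Re (f (z^*%C *: x)) by [].
rewrite fZ -/z normcJ.
have -> : complex.Re (z^*%C *: f x) = complex.Re (z * z^*%C) by rewrite mulrC.
by rewrite -sqr_normc nz expr2 -rmorphM.
Qed.

End hahn_banach.

(** * Bounded linear maps between normed spaces *)

Section bounded_linear.
Context {R : realType}.
Local Notation C := R[i].
Implicit Types V W : normedModType C.

(** A predicate on bare functions, so that maps written as formulas, such as [fun x => f (a ** x)],
    can be used without being bundled. *)
Definition bounded_linear V W (L : V -> W) :=
  linear L /\ exists2 M : C, 0 <= M & forall x, `|L x| <= M * `|x|.

Section theory.
Context {V W : normedModType C}.
Implicit Types (L K : V -> W) (x y : V).

Lemma bounded_linear_dual (f : V -> C^o) :
  bounded_linear f <-> f \in @dual_pred R V.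
Proof. exact: iff_sym (dual_predP f). Qed.

Lemma bounded_linearP (L : {linear V -> W}) : bounded_linear L <-> continuous L.
Proof.
split=> [[_ [M M0 LM]]|/linear_bounded_continuous/linear_boundedP].
  apply/linear_bounded_continuous/linear_boundedP.
  exists M; split=> [|r Mr x]; first exact: ger0_real.
  by rewrite (le_trans (LM x))// ler_wpM2r// ltW.
move=> /pinfty_ex_gt0[M M0 LM]; split; first exact: linearP.
by exists M; rewrite ?ltW.
Qed.

Lemma blinP L : bounded_linear L -> exists2 L0 : {linear V -> W},
  continuous L0 & L =1 L0.
Proof.
move=> bL; pose L0 : {linear V -> W} :=
  HB.pack L (GRing.isLinear.Build _ _ _ _ L bL.1).
by exists L0 => //; apply/bounded_linearP.
Qed.

Lemma blinD L x y : bounded_linear L -> L (x + y) = L x + L y.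
Proof. by move=> [lL _]; rewrite -[x]scale1r lL !scale1r. Qed.

Lemma blin0 L : bounded_linear L -> L 0 = 0.
Proof.
by move=> [lL _]; have := lL (-1) 0 0; rewrite scaler0 addr0 scaleN1r addNr.
Qed.

Lemma blinZ L (k : C) x : bounded_linear L -> L (k *: x) = k *: L x.
Proof. by move=> bL; rewrite -[k *: x]addr0 bL.1 (blin0 bL) addr0. Qed.

Lemma blinN L x : bounded_linear L -> L (- x) = - L x.
Proof. by move=> bL; rewrite -scaleN1r blinZ // scaleN1r. Qed.

Lemma blinB L x y : bounded_linear L -> L (x - y) = L x - L y.
Proof. by move=> bL; rewrite blinD // blinN. Qed.

Lemma bounded_linear0 : bounded_linear (fun _ : V => 0 : W).
Proof.
split=> [k x y|]; first by rewrite scaler0 addr0.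
by exists 0 => // x; rewrite normr0 mul0r.
Qed.

Lemma bounded_linearD L K : bounded_linear L -> bounded_linear K ->
  bounded_linear (fun x => L x + K x).
Proof.
move=> [lL [M M0 LM]] [lK [N N0 KN]]; split=> [k x y|].
  by rewrite lL lK scalerDr addrACA.
exists (M + N); first exact: addr_ge0.
by move=> x; rewrite (le_trans (ler_normD _ _))// mulrDl lerD.
Qed.

Lemma bounded_linearZ (k : C) L : bounded_linear L ->
  bounded_linear (fun x => k *: L x).
Proof.
move=> [lL [M M0 LM]]; split=> [l x y|].
  by rewrite lL scalerDr !scalerA mulrC.
exists (`|k| * M); first exact: mulr_ge0.
by move=> x; rewrite normrZ -mulrA ler_wpM2l.
Qed.

Lemma bounded_linearN L : bounded_linear L -> bounded_linear (fun x => - L x).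
Proof.
move=> /(bounded_linearZ (-1)); congr bounded_linear.
by apply/funext => x; rewrite scaleN1r.
Qed.

End theory.

Lemma bounded_linear_id V : bounded_linear (fun x : V => x).
Proof. by split=> [//|]; exists 1 => // x; rewrite mul1r. Qed.

Lemma bounded_linear_comp V W (Z : normedModType C) (L : W -> Z) (K : V -> W) :
  bounded_linear L -> bounded_linear K -> bounded_linear (fun x => L (K x)).
Proof.
move=> [lL [M M0 LM]] [lK [N N0 KN]]; split=> [k x y|].
  by rewrite lK lL.
exists (M * N); first exact: mulr_ge0.
by move=> x; rewrite (le_trans (LM _))// -mulrA ler_wpM2l.
Qed.

Lemma bounded_linear_scale V W (f : V -> C^o) (w : W) :
  bounded_linear f -> bounded_linear (fun x => f x *: w).
Proof.
move=> [lf [M M0 fM]]; split=> [k x y|].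
  by rewrite lf scalerDl -scalerA.
exists (M * `|w|); first exact: mulr_ge0.
by move=> x; rewrite normrZ mulrAC ler_wpM2r.
Qed.

Lemma bounded_linear_of_dual V (f : dual V) : bounded_linear f.
Proof. by apply/bounded_linear_dual; exact: dual_funP. Qed.

End bounded_linear.

(** * Norming functionals, separation of points, and closures of subspaces *)

Section dual_separation.
Context {R : realType} {V : normedModType R[i]}.
Local Notation C := R[i].

Lemma normReK (x : V) : (complex.Re `|x|)%:C%C = `|x|.
Proof. by rewrite RRe_real// ger0_real. Qed.

Lemma normReD (x y : V) :
  complex.Re `|x + y| <= complex.Re `|x| + complex.Re `|y|.
Proof. by rewrite -lecR rmorphD /= !normReK ler_normD. Qed.

Lemma normReZ (k : C) (x : V) :
  complex.Re `|k *: x| = complex.Re `|k| * complex.Re `|x|.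
Proof.
apply: (@complexI R).
by rewrite rmorphM /= !normReK normrZ -complex_normRe.
Qed.

Lemma norming_functional (x : V) :
  exists f : dual V, (forall y, `|f y| <= `|y|) /\ `|x| <= `|f x|.
Proof.
have [f [lf fp fx]] := hahn_banach_seminorm x normReD normReZ.
have fd : f \in @dual_pred R V.
  apply/dual_predP; split=> //; exists 1 => // y.
  by rewrite mul1r -normReK.
exists (Dual fd); split=> [y|]; first by rewrite -normReK.
rewrite -normReK -fx complex_normRe lecR.
exact: le_trans (ler_norm _) (normRe_le _).
Qed.

(** Besides descending from the bidual, this reduces identities between vectors to scalar identities
    that [ring] can settle. *)
Lemma dual_separates (x y : V) : (forall f : dual V, f x = f y) -> x = y.
Proof.
move=> fxy; apply/eqP; rewrite -subr_eq0 -normr_le0.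
have [f [_ /le_trans]] := norming_functional (x - y).
by apply; rewrite raddfB /= fxy subrr normr0.
Qed.

(** Hahn-Banach for the seminorm [p], the distance to [S]: the functional obtained vanishes on [S],
    hence at [x] by hypothesis, while its real part at [x] is [p x]. *)
Lemma dist_submod_functional (S : set V) (x : V) :
  S 0 -> (forall k y z, S y -> S z -> S (k *: y + z)) ->
  (forall f : dual V, (forall y, S y -> f y = 0) -> f x = 0) ->
  forall e : C, 0 < e -> exists2 y, S y & `|x - y| < e.
Proof.
move=> S0 Slin fx e' e'0; have e'E := RRe_real (gtr0_real e'0).
move: e'0; rewrite -e'E ltcR; set e := complex.Re e' => e0.
have SZ k y : S y -> S (k *: y).
  by move=> Sy; rewrite -[_ *: _]addr0; exact: Slin.
have SD y z : S y -> S z -> S (y + z).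
  by move=> Sy Sz; rewrite -[y]scale1r; exact: Slin.
pose D y := [set complex.Re `|y - z| | z in S].
pose p y := inf (D y).
have D0 y : D y !=set0 by exists (complex.Re `|y - 0|), 0.
have Dlb y : has_lbound (D y) by exists 0 => _ [z _ <-]; exact: Re_ge0.
have p_le y z : S z -> p y <= complex.Re `|y - z|.
  by move=> Sz; apply: ge_inf => //; exists z.
have pD y z : p (y + z) <= p y + p z.
  rewrite -lerBlDr; apply: lb_le_inf => // _ [y' Sy' <-].
  rewrite lerBlDr -lerBlDl; apply: lb_le_inf => // _ [z' Sz' <-].
  rewrite lerBlDl (le_trans (p_le _ _ (SD _ _ Sy' Sz')))//.
  by rewrite opprD addrACA normReD.
have p_ge0 y : 0 <= p y by apply: lb_le_inf => // _ [z _ <-]; exact: Re_ge0.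
have pZ_le k y : p (k *: y) <= complex.Re `|k| * p y.
  have [->|k0] := eqVneq k 0.
    rewrite scale0r normr0 mul0r (le_trans (p_le _ _ S0))//.
    by rewrite subr0 normr0.
  have nk0 : 0 < complex.Re `|k| by rewrite -ltcR -complex_normRe normr_gt0.
  rewrite -ler_pdivrMl//; apply: lb_le_inf => // _ [z Sz <-].
  by rewrite ler_pdivrMl// -normReZ scalerBr p_le//; exact: SZ.
have pZ k y : p (k *: y) = complex.Re `|k| * p y.
  apply/eqP; rewrite eq_le pZ_le andTb.
  have [->|k0] := eqVneq k 0; first by rewrite normr0 mul0r.
  have nk0 : 0 < complex.Re `|k| by rewrite -ltcR -complex_normRe normr_gt0.
  have := pZ_le k^-1 (k *: y); rewrite scalerA mulVf// scale1r normfV.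
  rewrite {1}complex_normRe -fmorphV /=.
  by rewrite mulrC ler_pdivlMr// mulrC.
have [f [lf fp fpx]] := hahn_banach_seminorm x pD pZ.
have fd : f \in @dual_pred R V.
  apply/dual_predP; split=> //; exists 1 => // y.
  rewrite mul1r (le_trans (fp y))// -normReK lecR.
  by rewrite (le_trans (p_le _ _ S0))// subr0.
have px0 : p x = 0.
  rewrite -fpx; suff -> : f x = 0 by [].
  apply: (fx (Dual fd)) => y Sy /=; apply/eqP; rewrite -normr_le0.
  rewrite (le_trans (fp y))// (_ : 0 = 0%:C%C)// lecR.
  by rewrite (le_trans (p_le _ _ Sy))// subrr normr0.
have [_ [y Sy <-]] := inf_adherent e0 (conj (D0 x) (Dlb x)).
rewrite -/(p x) px0 add0r => xy; exists y => //.
by rewrite -normReK ltcR.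
Qed.

End dual_separation.

(** The assumption on [g] places [a] in the closure of the subspace [S], and [S] is closed: a
    representing point has norm at most [c] times that of the represented element, so the points
    representing a sequence tending to [a] are Cauchy and converge in the complete space [W]. *)
Lemma represented_in_closure {R : realType} {V : normedModType R[i]}
    {W : completeNormedModType R[i]} (B : V -> dual W -> R[i]^o) (c : R[i]) :
  0 <= c -> (forall a f, `|B a f| <= c * `|a| * `|f|) ->
  (forall f, linear (B^~ f)) ->
  let S := [set a | exists y : W, forall f : dual W, f y = B a f] in
  forall a, (forall g : dual V, (forall s, S s -> g s = 0) -> g a = 0) -> S a.
Proof.
move=> c0 cB Blin S a ga.
have Bsub b b' f : B (b - b') f = B b f - B b' f.
  by rewrite addrC -scaleN1r (Blin f (-1) b' b) scaleN1r addrC.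
have norm_rep y b : (forall f : dual W, f y = B b f) -> `|y| <= c * `|b|.
  move=> yb; have [f [f1 /le_trans]] := norming_functional y; apply.
  rewrite yb (le_trans (cB _ _))// ler_piMr//; first exact: mulr_ge0.
  by apply: dual_norm_le => // x; rewrite mul1r.
pose A (d : R[i]) := [set y : W | exists2 s,
  (forall f : dual W, f y = B s f) & `|a - s| < d].
have A0 d : 0 < d -> A d !=set0.
  move=> d0; have [||s [y ys] sd] := @dist_submod_functional _ _ S a _ _ ga d d0.
  - exists 0 => f; rewrite raddf0.
    by have := Bsub 0 0 f; rewrite subr0 subrr.
  - move=> k b b' [y yb] [y' yb']; exists (k *: y + y') => f.
    by rewrite Blin -yb -yb'; exact: (dual_linear f).
  by exists y, s.
(* Sequences are replaced by the filter of points that represent elements of [S] near [a]; real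
   radii are totally ordered, so the smaller of two serves for an intersection. *)
pose F : set_system W := filter_from [set d : R | 0 < d] (fun d => A d%:C%C).
have FA d : 0 < d -> F (A d).
  move=> d0; have dE := RRe_real (gtr0_real d0).
  by exists (complex.Re d); rewrite /= ?dE// -ltcR dE.
have FF : ProperFilter F.
  apply: filter_from_proper; last by move=> d d0; apply: A0; rewrite ltcR.
  apply: filter_from_filter; first by exists 1; exact: ltr01.
  move=> d d' /= d0 d'0; exists (Num.min d d') => /=; first by rewrite lt_min d0.
  move=> y [s ys sd]; split; exists s => //; rewrite (lt_le_trans sd)// lecR.
    by rewrite ge_min lexx.
  by rewrite ge_min lexx orbT.
have Fc : cauchy F.
  apply/cauchyP => d d0.
  (* The factor 2 comes from passing through [a] between two elements of [S]; the 1 keeps the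
     divisor positive when [c] is 0. *)
  have c2 : 0 < c * 2 + 1 by rewrite ltr_wpDl// mulr_ge0.
  have e0 : 0 < d / (c * 2 + 1) by exact: divr_gt0.
  have [y0 [s0 ys0 as0]] := A0 _ e0.
  exists y0; apply: filterS (FA _ e0) => y [s ys ass]; rewrite -ball_normE /=.
  have : `|y0 - y| <= c * `|s0 - s|.
    by apply: norm_rep => f; rewrite Bsub -ys -ys0 raddfB.
  move=> /le_lt_trans; apply.
  have : `|s0 - s| <= d / (c * 2 + 1) * 2.
    have -> : s0 - s = (a - s) - (a - s0).
      by rewrite opprB [RHS]addrC addrA subrK.
    by rewrite (le_trans (ler_normB _ _))// mulrDr mulr1 lerD// ltW.
  move=> /(ler_wpM2l c0)/le_lt_trans; apply.
  have -> : c * (d / (c * 2 + 1) * 2) = (d * (c * 2)) / (c * 2 + 1) by ring.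
  by rewrite ltr_pdivrMr// ltr_pM2l// ltrDl.
have Fcvg : cvg F by exact: cauchy_cvg.
have /cvg_ex[y Fy0] := Fcvg.
have Fy d : 0 < d -> F [set z | `|y - z| < d].
  move=> d0; apply: Fy0; apply/nbhs_ballP; exists d => // z.
  by rewrite -ball_normE.
exists y => f.
apply/eqP; rewrite -subr_eq0 -normr_le0; apply/ler_addgt0Pr => d d0.
(* The errors in [f y] and in [B a f] add up to at most [|f| * (c + 1)] times the radius; the 1
   again avoids a zero divisor. *)
have c1 : 0 < `|f| * (c + 1) + 1 by rewrite ltr_wpDl// mulr_ge0// addr_ge0.
have e0 : 0 < d / (`|f| * (c + 1) + 1) by exact: divr_gt0.
set eps := d / _ in e0.
have [y' [[s ys ass] yy']] := filter_ex (filterI (FA _ e0) (Fy _ e0)).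
have -> : f y - B a f = f (y - y') - B (a - s) f.
  by rewrite Bsub raddfB -ys opprB addrA subrK.
rewrite add0r (le_trans (ler_normB _ _))//.
apply: (@le_trans _ _ (`|f| * eps + c * eps * `|f|)).
  apply: lerD.
    by rewrite (le_trans (ler_dual _ _))// ler_wpM2l// ltW.
  by rewrite (le_trans (cB _ _))// ler_wpM2r// ler_wpM2l// ltW.
have -> : `|f| * eps + c * eps * `|f| =
  d * (`|f| * (c + 1)) / (`|f| * (c + 1) + 1) by rewrite /eps; ring.
by rewrite ler_pdivrMr// ler_pM2l// lerDl.
Qed.

(** * Elements of the bidual, acting on functions *)

Section dual_functional.
Context {R : realType} {V : normedModType R[i]}.
Local Notation C := R[i].
Implicit Types (E : (V -> C^o) -> C^o) (f g : V -> C^o).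

(* Elements of the bidual, extended to arbitrary functions so that they can be
   applied to functionals given by a formula. *)
Definition dual_functional E :=
  (forall (k : C) f g, bounded_linear f -> bounded_linear g ->
    E (fun x => k *: f x + g x) = k *: E f + E g) /\
  exists2 K : C, 0 <= K & forall f c, bounded_linear f -> 0 <= c ->
    (forall x, `|f x| <= c * `|x|) -> `|E f| <= K * c.

Section theory.
Variables (E : (V -> C^o) -> C^o) (dE : dual_functional E).

Lemma dual_functional0 : E (fun=> 0) = 0.
Proof.
have := dE.1 (-1) _ _ bounded_linear0 bounded_linear0.
have -> : (fun x : V => -1 *: (0 : C^o) + 0) = (fun=> 0).
  by apply/funext => x; rewrite scaler0 addr0.
by rewrite scaleN1r addNr.
Qed.

Lemma dual_functionalZ (k : C) f : bounded_linear f ->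
  E (fun x => k *: f x) = k *: E f.
Proof.
move=> bf; have := dE.1 k _ _ bf bounded_linear0.
rewrite dual_functional0 addr0 => <-; congr E.
by apply/funext => x; rewrite addr0.
Qed.

Lemma dual_functionalB f g : bounded_linear f -> bounded_linear g ->
  E (fun x => f x - g x) = E f - E g.
Proof.
move=> bf bg; have := dE.1 (-1) _ _ bg bf; rewrite scaleN1r addrC => <-.
by congr E; apply/funext => x; rewrite scaleN1r addrC.
Qed.

(** Allows [E] to be applied in one variable of a bounded bilinear form, as an Arens product
    requires. *)
Lemma bounded_linear_dual_functional (W : normedModType C)
    (B : W -> V -> C^o) (c : C) : 0 <= c ->
  (forall w, bounded_linear (B w)) -> (forall x, linear (B^~ x)) ->
  (forall w x, `|B w x| <= c * `|w| * `|x|) ->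
  bounded_linear (fun w => E (B w)).
Proof.
move=> c0 bB lB cB; split=> [k w z|].
  rewrite -dE.1//; congr E; apply/funext => x; exact: lB.
have [K K0 EK] := dE.2; exists (K * c) => [|w]; first exact: mulr_ge0.
by rewrite -mulrA EK// mulr_ge0.
Qed.

Lemma dual_functional_comp (T : V -> V) : bounded_linear T ->
  dual_functional (fun f => E (fun x => f (T x))).
Proof.
move=> bT; split=> [k f g bf bg|].
  by rewrite dE.1//; exact: bounded_linear_comp.
have [K K0 EK] := dE.2; have [M M0 TM] := bT.2.
exists (K * M) => [|f c bf c0 fc]; first exact: mulr_ge0.
rewrite -mulrA EK//; first exact: bounded_linear_comp.
  exact: mulr_ge0.
by move=> x; rewrite (le_trans (fc _))// [M * c]mulrC -mulrA ler_wpM2l.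
Qed.

End theory.

Lemma dual_functional_lin (k : C) E F : dual_functional E -> dual_functional F ->
  dual_functional (fun f => k *: E f + F f).
Proof.
move=> dE dF; split=> [l f g bf bg|].
  rewrite dE.1// dF.1// scalerDr addrACA scalerDr; congr (_ + _ + _).
  by rewrite !scalerA mulrC.
have [K K0 EK] := dE.2; have [L L0 FL] := dF.2.
exists (`|k| * K + L) => [|f c bf c0 fc]; first by rewrite addr_ge0// mulr_ge0.
rewrite (le_trans (ler_normD _ _))// mulrDl lerD// ?FL//.
by rewrite normrZ -mulrA ler_wpM2l// EK.
Qed.

Lemma dual_functional_eval (x : V) : dual_functional (fun f => f x).
Proof.
split=> [//|]; exists `|x| => // f c bf c0 fc.
by rewrite mulrC.
Qed.

(** [insubd] replaces a function outside the dual by the zero functional; this default is harmless,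
    since the laws of [dual_functional] concern bounded linear arguments. *)
Definition bidual_apply (N : dual (dual V)) : (V -> C^o) -> C^o :=
  fun f => N (insubd 0 f).

Lemma bidual_applyE N (f : dual V) : bidual_apply N f = N f.
Proof. by rewrite /bidual_apply; congr (N _); apply: val_inj; rewrite valKd. Qed.

Lemma dual_functional_bidual N : dual_functional (bidual_apply N).
Proof.
have liftE f : bounded_linear f ->
    exists2 f0 : dual V, f = f0 & bidual_apply N f = N f0.
  move=> /bounded_linear_dual fd; exists (Dual fd) => //.
  exact: (bidual_applyE N (Dual fd)).
split=> [k f g bf bg|].
  have [f0 f0E ->] := liftE _ bf; have [g0 g0E ->] := liftE _ bg.
  transitivity (N (k *: f0 + g0)); last exact: linearP.
  rewrite -bidual_applyE; congr bidual_apply.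
  by apply/funext => x; rewrite f0E g0E.
exists `|N| => [//|f c bf c0 fc].
have [f0 f0E ->] := liftE _ bf; rewrite (le_trans (ler_dual _ _))// ler_wpM2l//.
by apply: dual_norm_le => // x; rewrite -f0E.
Qed.

End dual_functional.

(** * Amenability applied to bimodules carried by the algebra itself *)

Section banach_algebra.
Context {R : realType} {U : banachAlgType R}.
Local Notation C := R[i].
Implicit Types a b : U.

Lemma bounded_linear_bmull a : bounded_linear (fun x : U => a ** x).
Proof.
split=> [k x y|]; first by rewrite bmulDr bmulZr.
by exists `|a| => // x; exact: ler_bmul.
Qed.

Lemma bounded_linear_bmulr a : bounded_linear (fun x : U => x ** a).
Proof.
split=> [k x y|]; first by rewrite bmulDl bmulZl.
by exists `|a| => // x; rewrite mulrC ler_bmul.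
Qed.

(** Let [U] act on itself by [a ** T x] on the left and by [chi a *: x] on the right; the hypothesis
    on [T] makes the left action associative. Followed by the embedding into the bidual, [D] is a
    derivation into a dual bimodule, and [N] is an element that makes it inner. *)
Lemma amenable_functional (hU : amenable U) (T D : U -> U) (chi : U -> C^o) :
    bounded_linear T -> bounded_linear D -> bounded_linear chi ->
    (forall a x, T (a ** T x) = a ** T x) ->
    (forall a b, chi (a ** b) = chi a * chi b) ->
    (forall a b, D (a ** b) = chi b *: D a + a ** T (D b)) ->
  exists2 N, dual_functional N & forall a f, bounded_linear f ->
    f (D a) = N (fun x => f (a ** T x)) - chi a * N f.
Proof.
move=> bT bD bchi TT chiM DM.
have [[lT [M M0 TM]] [lchi [K K0 chiK]]] := (bT, bchi).
pose l (a x : U) := a ** T x; pose r (x a : U) := chi a *: x.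
have lDl a b x : l (a + b) x = l a x + l b x by exact: bmulDl.
have lDr a x y : l a (x + y) = l a x + l a y by rewrite /l blinD// bmulDr.
have lZl k a x : l (k *: a) x = k *: l a x by exact: bmulZl.
have lZr k a x : l a (k *: x) = k *: l a x by rewrite /l blinZ// bmulZr.
have rDl x y a : r (x + y) a = r x a + r y a by exact: scalerDr.
have rDr x a b : r x (a + b) = r x a + r x b by rewrite /r blinD// scalerDl.
have rZl k x a : r (k *: x) a = k *: r x a by rewrite /r !scalerA mulrC.
have rZr k x a : r x (k *: a) = k *: r x a by rewrite /r blinZ// scalerA.
have lA a b x : l a (l b x) = l (a ** b) x by rewrite /l TT bmulA.
have rA x a b : r (r x a) b = r x (a ** b) by rewrite /r scalerA chiM mulrC.
have lrA a x b : l a (r x b) = r (l a x) b by exact: lZr.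
have lM : exists L : C, forall a x, `|l a x| <= L * `|a| * `|x|.
  exists M => a x; rewrite (le_trans (ler_bmul _ _))//.
  by rewrite [M * _]mulrC -mulrA ler_wpM2l.
have rM : exists L : C, forall x a, `|r x a| <= L * `|x| * `|a|.
  by exists K => x a; rewrite normrZ mulrAC ler_wpM2r.
pose Y : banachBimodType U := HB.pack (BanachAlgebra.sort U)
  (isBanachBimodule.Build R U U lDl lDr lZl lZr rDl rDr rZl rZr lA rA lrA lM rM).
have evP (a : U) : (fun f : dual Y => f (D a) : C^o) \in @dual_pred R (dual Y).
  apply/dual_predP; split=> //; exists `|D a| => // f.
  by rewrite mulrC; exact: ler_dual.
pose ev a : dual (dual Y) := Dual (evP a).
have ev_linear : linear ev.
  by move=> k a b; apply: dual_ext => f /=; rewrite bD.1; exact: linearP.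
pose Phi : {linear U -> dual (dual Y)} :=
  HB.pack ev (GRing.isLinear.Build _ _ _ _ ev ev_linear).
have bPhi : bounded_linear Phi.
  split=> //; have [L L0 DL] := bD.2; exists L => // a.
  apply: dual_norm_le => [|f]; first exact: mulr_ge0.
  rewrite mulrC; apply: le_trans (ler_dual f (D a)) _.
  apply: ler_wpM2l => //; exact: DL.
have dPhi : derivation Phi.
  move=> a b; apply: dual_ext => f.
  rewrite dual_addE dual_lactE dual_ractE /= DM.
  exact: (raddfD f).
have /bounded_linearP/hU/(_ dPhi)[N NE] := bPhi.
exists (@bidual_apply R Y N); first exact: dual_functional_bidual.
move=> a f /bounded_linear_dual fd.
pose g : dual Y := Dual fd.
have -> : f (D a) = Phi a g by [].
rewrite NE dual_addE dual_oppE dual_lactE dual_ractE.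
have -> : (fun x => f (a ** T x)) = (g <* a : dual Y) by [].
have -> : a *> g = chi a *: g.
  by apply: dual_ext => x; rewrite dual_lactE dual_scaleE;
  exact: (blinZ _ _ (bounded_linear_of_dual g)).
have -> : @bidual_apply R Y N f = N g by exact: (bidual_applyE N g).
by rewrite (blinZ _ _ (bounded_linear_of_dual N)) (bidual_applyE N).
Qed.

End banach_algebra.

(** * The opposite algebra and the exchange of sides in bimodules *)

Section opposite_algebra.
Context {R : realType}.
Local Notation C := R[i].

(** A new name for the same carrier, so that the reversed product does not clash with the one
    already declared on [U]. *)
Definition opposite (U : Type) := U.

Section algebra.
Variable U : banachAlgType R.

HB.instance Definition _ := CompleteNormedModule.on (opposite U).

Definition opp_bmul (a b : opposite U) : opposite U := (b : U) ** (a : U).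

Let opp_bmulA (a b c : opposite U) :
  opp_bmul a (opp_bmul b c) = opp_bmul (opp_bmul a b) c.
Proof. by rewrite /opp_bmul bmulA. Qed.

Let opp_bmulDl (a b c : opposite U) :
  opp_bmul (a + b) c = opp_bmul a c + opp_bmul b c.
Proof. exact: bmulDr. Qed.

Let opp_bmulDr (a b c : opposite U) :
  opp_bmul a (b + c) = opp_bmul a b + opp_bmul a c.
Proof. exact: bmulDl. Qed.

Let opp_bmulZl (k : C) (a b : opposite U) :
  opp_bmul (k *: a) b = k *: opp_bmul a b.
Proof. exact: bmulZr. Qed.

Let opp_bmulZr (k : C) (a b : opposite U) :
  opp_bmul a (k *: b) = k *: opp_bmul a b.
Proof. exact: bmulZl. Qed.

Let ler_opp_bmul (a b : opposite U) : `|opp_bmul a b| <= `|a| * `|b|.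
Proof. by rewrite mulrC; exact: ler_bmul. Qed.

HB.instance Definition _ := isBanachAlgebra.Build R (opposite U)
  opp_bmulA opp_bmulDl opp_bmulDr opp_bmulZl opp_bmulZr ler_opp_bmul.

End algebra.

End opposite_algebra.

(* [HB.pack] on the carrier of a bimodule would reuse the actions it already
   carries; here the carrier is only known as a Banach space. *)
Definition pack_bimodule (R : realType) (A : banachAlgType R)
    (V : completeNormedModType R[i]) (m : isBanachBimodule R A V) :
    banachBimodType A :=
  HB.pack (CompleteNormedModule.sort V) m.

Section antipullback.
Context {R : realType} {A B : banachAlgType R}.
Local Notation C := R[i].
Variables (theta : A -> B) (btheta : bounded_linear theta).
Hypothesis thetaM : forall a b, theta (a ** b) = theta b ** theta a.
Variable X : banachBimodType B.
Implicit Types (a b : A) (x y : X).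

Let l a x : X := x <* theta a.
Let r x a : X := theta a *> x.

Let lDl a b x : l (a + b) x = l a x + l b x.
Proof. by rewrite /l blinD// ractDr. Qed.

Let lDr a x y : l a (x + y) = l a x + l a y.
Proof. exact: ractDl. Qed.

Let lZl (k : C) a x : l (k *: a) x = k *: l a x.
Proof. by rewrite /l blinZ// ractZr. Qed.

Let lZr (k : C) a x : l a (k *: x) = k *: l a x.
Proof. exact: ractZl. Qed.

Let rDl x y a : r (x + y) a = r x a + r y a.
Proof. exact: lactDr. Qed.

Let rDr x a b : r x (a + b) = r x a + r x b.
Proof. by rewrite /r blinD// lactDl. Qed.

Let rZl (k : C) x a : r (k *: x) a = k *: r x a.
Proof. exact: lactZr. Qed.

Let rZr (k : C) x a : r x (k *: a) = k *: r x a.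
Proof. by rewrite /r blinZ// lactZl. Qed.

Let lA a b x : l a (l b x) = l (a ** b) x.
Proof. by rewrite /l thetaM ractA. Qed.

Let rA x a b : r (r x a) b = r x (a ** b).
Proof. by rewrite /r thetaM lactA. Qed.

Let lrA a x b : l a (r x b) = r (l a x) b.
Proof. by rewrite /l /r lractA. Qed.

Let lM : exists M : C, forall a x, `|l a x| <= M * `|a| * `|x|.
Proof.
have [_ [K K0 thetaK]] := btheta; have [M M0 XM] := ract_boundedP (X := X).
exists (M * K) => a x; rewrite (le_trans (XM _ _))// mulrAC ler_wpM2r//.
by rewrite -mulrA ler_wpM2l.
Qed.

Let rM : exists M : C, forall x a, `|r x a| <= M * `|x| * `|a|.
Proof.
have [_ [K K0 thetaK]] := btheta; have [M M0 XM] := lact_boundedP (X := X).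
exists (M * K) => x a; rewrite (le_trans (XM _ _))// [leRHS]mulrAC ler_wpM2r//.
by rewrite -mulrA ler_wpM2l.
Qed.

(** Restriction of scalars along an anti-homomorphism, which exchanges the two sides. A general
    [theta] covers the identity both from [U] to [opposite U] and back. *)
Definition antipullback : banachBimodType A :=
  @pack_bimodule R A X (isBanachBimodule.Build R A X
    lDl lDr lZl lZr rDl rDr rZl rZr lA rA lrA lM rM).

End antipullback.

(** Exchanging sides commutes with taking the dual, so [D] is also a derivation over [U]. In
    [a *> N - N <* a] the exchange reverses the sign, hence the witness [- N']. *)
Lemma amenable_opposite (R : realType) (U : banachAlgType R) :
  amenable U -> amenable (opposite U).
Proof.
move=> hU X D cD dD.
pose theta : U -> opposite U := id.
have btheta : bounded_linear theta := bounded_linear_id U.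
have thetaM a b : theta (a ** b) = theta b ** theta a by [].
pose Y : banachBimodType U := antipullback btheta thetaM X.
pose D' : {linear U -> dual Y} := D.
have dD' : derivation D'.
  move=> a b; have := dD b a; rewrite addrC => DE.
  by apply: etrans DE _; congr (_ + _); exact: dual_ext.
have [N NE] := hU Y D' cD dD'.
pose N' : dual X := N.
exists (- N') => a; apply: dual_ext => x.
rewrite dual_addE dual_oppE dual_lactE dual_ractE !dual_oppE opprK addrC.
have := congr1 (fun f : dual Y => f x) (NE a).
by rewrite dual_addE dual_oppE dual_lactE dual_ractE.
Qed.

(** * A two-sided unit in the bidual for the kernel of a character *)

Section kernel_unit.
Context {R : realType}.
Local Notation C := R[i].

Lemma character_decomp (U : banachAlgType R) (phi : U -> C^o) (e a : U) :
  bounded_linear phi -> phi e = 1 -> phi (a - phi a *: e) = 0.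
Proof.
move=> bphi phie; rewrite blinB// blinZ// phie /GRing.scale /= mulr1.
exact: subrr.
Qed.

(** Amenability is used twice. With zero right action it gives a right unit [N] for all of [U].
    Subtracting [e] makes it kill [phi], but on the kernel an error [a ** e] appears. The map [D]
    takes values in the kernel, equals [a ** e] for [a] in the kernel, and is a derivation when the
    right action is by [phi]; the functional [M] that implements it, composed with the projection
    [P], repairs the error and still kills [phi]. *)
Lemma amenable_right_unit (U : banachAlgType R) (hU : amenable U)
    (phi : U -> C^o) (e : U) :
  bounded_linear phi -> (forall a b, phi (a ** b) = phi a * phi b) -> phi e = 1 ->
  exists E : (U -> C^o) -> C^o, [/\ dual_functional E, E phi = 0 &
    forall a f, phi a = 0 -> bounded_linear f -> E (fun x => f (a ** x)) = f a].
Proof.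
move=> bphi phiM phie.
have [N dN NE] : exists2 N : (U -> C^o) -> C^o, dual_functional N &
    forall a f, bounded_linear f ->
    f a = N (fun x => f (a ** x)) - 0 * N f.
  apply: (amenable_functional hU (T := id) (D := id) (chi := fun=> 0)).
  - exact: bounded_linear_id.
  - exact: bounded_linear_id.
  - exact: bounded_linear0.
  - by [].
  - by move=> a b; rewrite mulr0.
  - by move=> a b; rewrite scale0r add0r.
pose P (x : U) := x - phi x *: e.
have bP : bounded_linear P.
  apply: bounded_linearD; first exact: bounded_linear_id.
  by apply: bounded_linearN; exact: bounded_linear_scale.
have phiP x : phi (P x) = 0 by exact: character_decomp.
have PE x : phi x = 0 -> P x = x by move=> px; rewrite /P px scale0r subr0.
have phi_aP a x : phi (a ** P x) = 0 by rewrite phiM phiP mulr0.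
pose D (a : U) := a ** e - phi a *: e.
have phiD a : phi (D a) = 0.
  by rewrite blinB// blinZ// phiM phie mulr1 /GRing.scale /= mulr1 subrr.
have [M dM ME] : exists2 M : (U -> C^o) -> C^o, dual_functional M &
    forall a f, bounded_linear f ->
    f (D a) = M (fun x => f (a ** P x)) - phi a * M f.
  apply: (amenable_functional hU) => //.
  - apply: bounded_linearD; first exact: bounded_linear_bmulr.
    by apply: bounded_linearN; exact: bounded_linear_scale.
  - by move=> a x; rewrite PE.
  - move=> a b; rewrite (PE (D b))// /D phiM.
    rewrite (blinB _ _ (bounded_linear_bmull a)) bmulZr scalerBr bmulA [RHS]addrC.
    by rewrite addrA subrK scalerA mulrC.
pose E f := N f - f e + M (fun x => f (P x)).
exists E; split.
- have -> : E =
      (fun f => 1 *: (-1 *: (fun g => g e) f + N f) + M (fun x => f (P x))).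
    by apply/funext => f; rewrite scale1r scaleN1r [- _ + _]addrC.
  apply: dual_functional_lin; last exact: dual_functional_comp.
  by apply: dual_functional_lin => //; exact: dual_functional_eval.
- rewrite /E (_ : (fun x => phi (P x)) = fun=> 0); last exact/funext.
  rewrite dual_functional0// addr0 phie.
  have := NE e phi bphi; rewrite mul0r subr0 phie => N1.
  have -> : N phi = 1; last by rewrite subrr.
  by rewrite N1; congr N; apply/funext => x; rewrite phiM phie mul1r.
- move=> a f pa bf; rewrite /E.
  have := NE a f bf; rewrite mul0r subr0 => <-.
  have := ME a f bf; rewrite pa mul0r subr0 => <-.
  by rewrite /D pa scale0r subr0; ring.
Qed.

(* If [E1] is a right unit and [E2] a left unit, [E1 + E2 - E1 E2] is both; the
   Arens product [E1 E2] applies [E1] first. *)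
Lemma amenable_kernel_unit (U : banachAlgType R) (hU : amenable U)
    (phi : U -> C^o) (e : U) :
  bounded_linear phi -> (forall a b, phi (a ** b) = phi a * phi b) -> phi e = 1 ->
  exists E : (U -> C^o) -> C^o, [/\ dual_functional E, E phi = 0,
    forall a f, phi a = 0 -> bounded_linear f -> E (fun x => f (a ** x)) = f a &
    forall a f, phi a = 0 -> bounded_linear f -> E (fun x => f (x ** a)) = f a].
Proof.
move=> bphi phiM phie.
have [E1 [d1 E1phi E1u]] := amenable_right_unit hU bphi phiM phie.
have phiMop (a b : opposite U) : phi (a ** b) = phi a * phi b.
  by rewrite mulrC; exact: phiM.
(* A left unit is a right unit of the opposite algebra. *)
have [E2 [d2 E2phi E2u]] :
    exists E : (U -> C^o) -> C^o, [/\ dual_functional E, E phi = 0 &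
    forall a f, phi a = 0 -> bounded_linear f -> E (fun x => f (x ** a)) = f a].
  exact: (amenable_right_unit (amenable_opposite hU) bphi phiMop phie).
pose K f x := E1 (fun y => f (y ** x)).
have bK f : bounded_linear f -> bounded_linear (K f).
  move=> bf; have [_ [c c0 fc]] := bf.
  apply: (bounded_linear_dual_functional d1 c0).
  - by move=> w; apply: bounded_linear_comp bf (bounded_linear_bmulr w).
  - by move=> x k w z; rewrite bmulDr bmulZr bf.1.
  - move=> w x; rewrite (le_trans (fc _))// -mulrA ler_wpM2l// mulrC.
    exact: ler_bmul.
pose E f := E1 f + E2 f - E2 (K f).
exists E; split.
- split=> [k f g bf bg|].
    rewrite /E.
    have -> : K (fun x => k *: f x + g x) = (fun x => k *: K f x + K g x).
      by apply/funext => x; rewrite /K d1.1//;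
        exact: bounded_linear_comp (bounded_linear_bmulr x).
    rewrite d1.1// !d2.1//; [|exact: bK|exact: bK].
    by rewrite !scalerBr !scalerDr; ring.
  have [[k1 k10 E1k] [k2 k20 E2k]] := (d1.2, d2.2).
  exists (k1 + k2 + k2 * k1) => [|f c bf c0 fc].
    by rewrite !addr_ge0// mulr_ge0.
  rewrite (le_trans (ler_normB _ _))// mulrDl lerD//.
    by rewrite (le_trans (ler_normD _ _))// mulrDl lerD ?E1k ?E2k.
  rewrite -mulrA E2k//; [exact: bK|exact: mulr_ge0|].
  move=> x; rewrite -mulrA E1k//.
  - exact: bounded_linear_comp (bounded_linear_bmulr x).
  - exact: mulr_ge0.
  - move=> y; rewrite (le_trans (fc _))// -mulrA ler_wpM2l// mulrC.
    exact: ler_bmul.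
- rewrite /E E1phi E2phi add0r sub0r.
  have -> : K phi = fun=> 0.
    apply/funext => x; rewrite /K.
    have -> : (fun y => phi (y ** x)) = (fun y => phi x *: phi y).
      by apply/funext => y; rewrite phiM mulrC.
    by rewrite dual_functionalZ// E1phi scaler0.
  by rewrite dual_functional0// oppr0.
- move=> a f pa bf; rewrite /E E1u//.
  rewrite (_ : K _ = fun x => f (a ** x)) ?addrK//.
  apply/funext => x; rewrite /K -(E1u _ (fun y => f (y ** x)) pa).
    by congr E1; apply/funext => y; rewrite bmulA.
  exact: bounded_linear_comp (bounded_linear_bmulr x).
- move=> a f pa bf; rewrite /E E2u//.
  have -> : K (fun x => f (x ** a)) = (fun x => K f (x ** a)).
    by apply/funext => x; congr E1; apply/funext => y; rewrite bmulA.
  by rewrite (E2u _ (K f) pa (bK _ bf)) /K; ring.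
Qed.

End kernel_unit.

(** * Decomposition of a Lie derivation when the right action is scalar *)

Section lie_derivation_right_scalar.
Context {R : realType} {U : banachAlgType R} {X : banachBimodType U}.
Local Notation C := R[i].
Variables (phi : U -> C^o) (e : U) (delta : U -> X).
Hypotheses (bphi : bounded_linear phi)
  (phiM : forall a b, phi (a ** b) = phi a * phi b) (phie : phi e = 1)
  (bdelta : bounded_linear delta)
  (delta_lie : forall a b, delta (a ** b - b ** a) =
     (a *> delta b - phi a *: delta b) - (b *> delta a - phi b *: delta a)).
Variable E : (U -> C^o) -> C^o.
Hypotheses (dE : dual_functional E) (Ephi : E phi = 0)
  (Er : forall a f, phi a = 0 -> bounded_linear f ->
    E (fun x => f (a ** x)) = f a)
  (El : forall a f, phi a = 0 -> bounded_linear f ->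
    E (fun x => f (x ** a)) = f a).
Implicit Types (a b c u v x : U) (f : dual X).

Let scaleC (k l : C^o) : k *: l = l *: k. Proof. exact: mulrC. Qed.

Let bf f : bounded_linear f := bounded_linear_of_dual f.

Lemma bounded_linear_lact a : bounded_linear (fun x : X => a *> x).
Proof.
have [M M0 XM] := lact_boundedP (X := X).
split=> [k x y|]; first by rewrite lactDr lactZr.
by exists (M * `|a|) => [|x]; [exact: mulr_ge0|exact: XM].
Qed.

Lemma bounded_linear_lactl (y : X) : bounded_linear (fun a : U => a *> y).
Proof.
have [M M0 XM] := lact_boundedP (X := X).
split=> [k a b|]; first by rewrite lactDl lactZl.
by exists (M * `|y|) => [|a]; [exact: mulr_ge0|rewrite mulrAC; exact: XM].
Qed.

Let P x := x - phi x *: e.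

Let bP : bounded_linear P.
Proof.
apply: bounded_linearD; first exact: bounded_linear_id.
by apply: bounded_linearN; exact: bounded_linear_scale.
Qed.

Let phiP x : phi (P x) = 0. Proof. exact: character_decomp. Qed.

Let PE x : phi x = 0 -> P x = x.
Proof. by move=> px; rewrite /P px scale0r subr0. Qed.

Let phil a x : phi a = 0 -> phi (a ** x) = 0.
Proof. by move=> pa; rewrite phiM pa mul0r. Qed.

Let phir a x : phi a = 0 -> phi (x ** a) = 0.
Proof. by move=> pa; rewrite phiM pa mulr0. Qed.

(** [E] kills [phi], so the variable under [E] may be projected into the kernel. *)
Let E_P (f : U -> C^o) : bounded_linear f -> E (fun x => f (P x)) = E f.
Proof.
move=> b_f.
have -> : (fun x => f (P x)) = (fun x => f x - f e *: phi x).
  by apply/funext => x; rewrite /P blinB// blinZ// scaleC.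
rewrite dual_functionalB// ?dual_functionalZ// ?Ephi ?scaler0 ?subr0//.
exact: bounded_linearZ.
Qed.

(** Density of the span of products, in dual form: [f (L a)] is [E] of [f (L (x ** a))], where [x]
    may be replaced by [P x], which makes [x ** a] a product of kernel elements. *)
Lemma kernel_products_dense (W : normedModType C) (L : U -> W) :
  bounded_linear L -> (forall a b, phi a = 0 -> phi b = 0 -> L (a ** b) = 0) ->
  forall a, phi a = 0 -> L a = 0.
Proof.
move=> bL L0 a pa; apply: dual_separates => f.
have bfL : bounded_linear (fun x => f (L x) : C^o).
  exact: bounded_linear_comp (bounded_linear_of_dual f) bL.
have bfLa : bounded_linear (fun x => f (L (x ** a)) : C^o).
  exact: bounded_linear_comp bfL (bounded_linear_bmulr a).
rewrite -(El pa bfL) -(E_P bfLa).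
rewrite (_ : (fun x => _) = fun=> 0) ?dual_functional0 ?raddf0//.
by apply/funext => x; rewrite L0// raddf0.
Qed.

(* Apply [E] in [e'] to [f (c *> _)] of the Lie identity for [[a, e']]: the
   commutator is killed, and [f (c *> delta a)] is a function of [c ** a]. *)
Lemma lact_lie_derivation_kernel a b c : phi a = 0 -> phi b = 0 -> phi c = 0 ->
  c *> delta (a ** b) = c *> (a *> delta b).
Proof.
move=> pa pb pc; apply: dual_separates => f.
have key x y : phi x = 0 -> phi y = 0 ->
    f (y *> delta x) = E (fun u => f ((y ** x) *> delta u)).
  move=> px py.
  pose g u : C^o := f (y *> delta u).
  have bg : bounded_linear g.
    apply: bounded_linear_comp (bf f) _.
    exact: bounded_linear_comp (bounded_linear_lact y) bdelta.
  have bgx : bounded_linear (fun u => g (x ** u)).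
    exact: bounded_linear_comp bg (bounded_linear_bmull x).
  have bgx' : bounded_linear (fun u => g (u ** x)).
    exact: bounded_linear_comp bg (bounded_linear_bmulr x).
  pose h u : C^o := f (u *> delta x).
  have bh : bounded_linear h.
    exact: bounded_linear_comp (bf f) (bounded_linear_lactl _).
  have bhy : bounded_linear (fun u => h (y ** u)).
    exact: bounded_linear_comp bh (bounded_linear_bmull y).
  have bhp : bounded_linear (fun u => phi u *: g x).
    exact: bounded_linear_scale.
  have bk : bounded_linear (fun u : U => f ((y ** x) *> delta u) : C^o).
    apply: bounded_linear_comp (bf f) _.
    exact: bounded_linear_comp (bounded_linear_lact _) bdelta.
  have := dual_functionalB dE bgx bgx'; rewrite Er// El// subrr.
  have -> : (fun u => g (x ** u) - g (u ** x)) =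
     (fun u => f ((y ** x) *> delta u) - (h (y ** u) - g x *: phi u)).
    apply/funext => u; rewrite -(blinB _ _ bg) /g delta_lie px scale0r subr0.
    rewrite !(blinB _ _ (bounded_linear_lact y)).
    rewrite (blinZ _ _ (bounded_linear_lact y)) !lactA.
    by rewrite !(blinB _ _ (bf f)) (blinZ _ _ (bf f)) scaleC.
  have bgp : bounded_linear (fun u => g x *: phi u) by exact: bounded_linearZ.
  rewrite dual_functionalB//; last first.
    by apply: bounded_linearD => //; exact: bounded_linearN.
  rewrite dual_functionalB// dual_functionalZ// Ephi scaler0 subr0 Er//.
  by move=> /subr0_eq ->.
rewrite key ?phil// lactA key ?phil//.
by congr E; apply/funext => u; rewrite bmulA.
Qed.

(* [dI u] is the weak limit along [E] of [x *> delta (P u)]. It exists in [X],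
   and not only in the bidual, on products of elements of the kernel, hence on
   the closure of their span. *)
Lemma kernel_derivation : exists dI : U -> X, [/\ bounded_linear dI,
  forall u, dI (P u) = dI u &
  forall a b, phi a = 0 -> phi b = 0 -> dI (a ** b) = a *> delta b].
Proof.
pose B u f : C^o := E (fun x => f (x *> delta (P u))).
have bBx (y : X) f : bounded_linear (fun x : U => f (x *> y) : C^o).
  exact: bounded_linear_comp (bf f) (bounded_linear_lactl y).
have [c c0 cB] : exists2 c : C, 0 <= c & forall u f, `|B u f| <= c * `|u| * `|f|.
  have [K K0 EK] := dE.2; have [M M0 XM] := lact_boundedP (X := X).
  have [_ [L L0 dL]] := bounded_linear_comp bdelta bP.
  exists (K * (M * L)) => [|u f]; first by rewrite !mulr_ge0.
  have fM x : `|f (x *> delta (P u))| <= (`|f| * (M * (L * `|u|))) * `|x|.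
    rewrite (le_trans (ler_dual _ _))// -mulrA ler_wpM2l//.
    rewrite (le_trans (XM _ _))// mulrAC ler_wpM2r// ler_wpM2l//; exact: dL.
  have : `|B u f| <= K * (`|f| * (M * (L * `|u|))).
    by apply: EK fM; [exact: bBx|rewrite !mulr_ge0].
  by congr (_ <= _); ring.
have Blin f : linear (B^~ f).
  move=> k u v; rewrite /B -dE.1//; congr E; apply/funext => x.
  rewrite bP.1 bdelta.1 (blinD _ _ (bounded_linear_lact x)).
  by rewrite (blinZ _ _ (bounded_linear_lact x)) blinD// blinZ.
have B_prod a b f : phi a = 0 -> phi b = 0 -> f (a *> delta b) = B (a ** b) f.
  move=> pa pb.
  have bh1 := bBx (a *> delta b) f; have bh2 := bBx (delta (a ** b)) f.
  (* Projecting the variable of [E] into the kernel makes [lact_lie_derivation_kernel] applicable;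
     the projection is then undone and [El] evaluates [E]. *)
  rewrite /B (PE (phil _ pa)) -(E_P bh2).
  have -> : (fun x => f (P x *> delta (a ** b))) =
            (fun x => f (P x *> (a *> delta b))).
    by apply/funext => x; rewrite lact_lie_derivation_kernel.
  rewrite (E_P bh1) -[LHS](El pa (bBx (delta b) f)).
  by congr E; apply/funext => x; rewrite lactA.
have BP u f : B (P u) f = B u f by rewrite /B (PE (phiP u)).
have rep u : exists y : X, forall f, f y = B u f.
  have [g gS|y yP] := represented_in_closure c0 cB Blin (a := P u); last first.
    by exists y => f; rewrite yP BP.
  apply: (kernel_products_dense (bounded_linear_of_dual g)) => // a b pa pb.
  by apply: gS; exists (a *> delta b) => f; exact: B_prod.
have [dI dIP] := choice rep.
exists dI; split=> [|u|a b pa pb]; last 2 first.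
- by apply: dual_separates => f; rewrite !dIP BP.
- by apply: dual_separates => f; rewrite dIP B_prod.
split=> [k u v|].
  apply: dual_separates => f; rewrite dIP Blin blinD// blinZ//.
  by rewrite !dIP.
exists c => // u; have [f [f1 /le_trans]] := norming_functional (dI u); apply.
rewrite dIP (le_trans (cB _ _))// ler_piMr//; first exact: mulr_ge0.
by apply: dual_norm_le => // x; rewrite mul1r.
Qed.

(** Along [a = P a + phi a *: e], [d] is [dI] on the kernel and [s] at [e]. The remainder
    [delta - d] is [kap] on the kernel and [t] at [e]; the kernel annihilates both and [e] fixes
    both, which is centrality for a scalar right action. *)
Theorem lie_derivation_right_scalar_decomp : exists d : U -> X,
  [/\ bounded_linear d, forall a b, d (a ** b) = phi b *: d a + a *> d b &
      forall a b, a *> (delta b - d b) = phi a *: (delta b - d b)].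
Proof.
have [dI [bdI dI_P dIM]] := kernel_derivation.
have blactd (L : U -> X) x : bounded_linear L -> bounded_linear (fun u => x *> L u).
  by move=> bL; exact: bounded_linear_comp (bounded_linear_lact x) bL.
have bsub (L K : U -> X) : bounded_linear L -> bounded_linear K ->
    bounded_linear (fun u => L u - K u).
  by move=> bL bK; apply: bounded_linearD => //; exact: bounded_linearN.
have bml (L : U -> X) x : bounded_linear L -> bounded_linear (fun u => L (x ** u)).
  by move=> bL; exact: bounded_linear_comp bL (bounded_linear_bmull x).
have bmr (L : U -> X) x : bounded_linear L -> bounded_linear (fun u => L (u ** x)).
  by move=> bL; exact: bounded_linear_comp bL (bounded_linear_bmulr x).
have lactB x (y z : X) : x *> (y - z) = x *> y - x *> z.
  exact: blinB (bounded_linear_lact x).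
have lactBl x x' (y : X) : (x - x') *> y = x *> y - x' *> y.
  exact: blinB (bounded_linear_lactl y).
(* Here and wherever [kernel_products_dense] is called, it suffices to compute on products of kernel
   elements, where [dIM] gives [dI]. *)
have dI_delta c a : phi c = 0 -> phi a = 0 -> c *> dI a = c *> delta a.
  move=> pc pa; apply/subr0_eq; move: a pa.
  apply: (kernel_products_dense (L := fun a => c *> dI a - c *> delta a)).
    by apply: bsub; exact: blactd.
  by move=> a b pa pb; rewrite dIM// lact_lie_derivation_kernel// subrr.
have dI_l u a : phi a = 0 -> dI (u ** a) = u *> dI a.
  move=> pa; apply/subr0_eq; move: a pa.
  apply: (kernel_products_dense (L := fun a => dI (u ** a) - u *> dI a)).
    by apply: bsub; [exact: bml|exact: blactd].
  by move=> a b pa pb; rewrite bmulA !dIM ?phir// lactA subrr.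
have delta_e b c : phi b = 0 -> phi c = 0 ->
    b *> delta (e ** c) = (b ** e) *> delta c.
  move=> pb pc; apply/subr0_eq; move: c pc.
  apply: (kernel_products_dense
    (L := fun c => b *> delta (e ** c) - (b ** e) *> delta c)).
    by apply: bsub; [exact: blactd (bml _ _ bdelta)|exact: blactd].
  move=> c c' pc pc'; have pec := phir e pc; have pbe := phil e pb.
  rewrite bmulA !lact_lie_derivation_kernel//.
  by rewrite !lactA -!bmulA subrr.
have lie_e a : phi a = 0 ->
    delta (a ** e) - delta (e ** a) = a *> delta e - (e *> delta a - delta a).
  by move=> pa; rewrite -(blinB _ _ bdelta) delta_lie pa phie
    scale0r subr0 scale1r.
have dI_r a : phi a = 0 -> dI (a ** e) = dI a + a *> delta e.
  move=> pa; apply/subr0_eq; move: a pa.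
  apply: (kernel_products_dense
    (L := fun a => dI (a ** e) - (dI a + a *> delta e))).
    apply: bsub; first exact: bmr.
    by apply: bounded_linearD => //; exact: bounded_linear_lactl.
  move=> a b pa pb; rewrite -bmulA !dIM ?phil//.
  (* The Lie identity for [b] and [e] trades [delta (b ** e)] for [delta (e ** b)]; by [delta_e] the
     two terms with [a ** e] then cancel. *)
  have -> : delta (b ** e) =
      delta (e ** b) + (b *> delta e - (e *> delta b - delta b)).
    by rewrite -lie_e// addrC subrK.
  rewrite lactDr delta_e// 2!lactB !lactA.
  by apply: dual_separates => f; rewrite ?(raddfB f, raddfD f) (raddf0 f); ring.
(* The future central part on the kernel: there it is annihilated by the kernel and is a trace. *)
pose kap a := delta a - dI a.
have kap_Z b a : phi b = 0 -> phi a = 0 -> b *> kap a = 0.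
  by move=> pb pa; rewrite /kap lactB dI_delta// subrr.
have bkap : bounded_linear kap by exact: bsub.
have kap_tr a b : phi a = 0 -> phi b = 0 -> kap (a ** b) = kap (b ** a).
  move=> pa pb; apply/subr0_eq; rewrite -(blinB _ _ bkap) /kap delta_lie pa pb.
  by rewrite !scale0r !subr0 (blinB _ _ bdI) !dIM// subrr.
have kap_e a : phi a = 0 -> kap (a ** e) - kap (e ** a) = kap a - e *> kap a.
  move=> pa.
  have -> : kap (a ** e) - kap (e ** a) = (delta (a ** e) - delta (e ** a)) -
      (dI a + a *> delta e - e *> dI a).
    rewrite -dI_r// -dI_l// /kap.
    by apply: dual_separates => f; rewrite ?(raddfB f, raddfD f); ring.
  rewrite lie_e// /kap lactB.
  by apply: dual_separates => f; rewrite ?(raddfB f, raddfD f); ring.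
have e_kap a : phi a = 0 -> e *> kap a = kap a.
  move=> pa; apply/esym/subr0_eq; move: a pa.
  apply: (kernel_products_dense (L := fun a => kap a - e *> kap a)).
    by apply: bsub => //; exact: blactd.
  move=> a b pa pb; rewrite -kap_e ?phil//.
  (* The trace property moves [e] around: [kap] takes equal values at [a ** b ** e], [b ** e ** a]
     and [e ** a ** b]. *)
  have pbe := phil e pb; have pea := phir e pa.
  rewrite -bmulA kap_tr// -bmulA kap_tr//.
  by rewrite bmulA subrr.
(* The value [s = delta e - t] of [d] at [e] is dictated by the derivation law: at [e ** e = e + i]
   it requires [e *> s = dI i], and at [a ** e] with [a] in the kernel it requires
   [a *> s = a *> delta e]. Both follow once the kernel annihilates [t] and [e *> t = t]. *)
pose i := e ** e - e.
have pi0 : phi i = 0 by rewrite /i blinB// phiM phie mulr1 subrr.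
pose t := e *> delta e - dI i.
have t_Z b : phi b = 0 -> b *> t = 0.
  move=> pb; rewrite /t lactB -dI_l// /i.
  rewrite (blinB _ _ (bounded_linear_bmull b)) bmulA.
  by rewrite (blinB _ _ bdI) dI_r ?phil// addrAC subrr add0r lactA subrr.
have e_t : e *> t = t.
  (* Since [i] commutes with [e], [e *> dI i] is [dI (i ** e)], which [dI_r] computes. *)
  have ei : e ** i = i ** e.
    rewrite /i (blinB _ _ (bounded_linear_bmull e)).
    by rewrite (blinB _ _ (bounded_linear_bmulr e)) bmulA.
  rewrite {1}/t lactB -dI_l// ei dI_r// {2}/i lactBl lactA /t.
  by apply: dual_separates => f; rewrite ?(raddfB f, raddfD f); ring.
pose s := delta e - t.
pose d u := phi u *: s + dI u.
exists d; split.
- by apply: bounded_linearD => //; exact: bounded_linear_scale.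
- move=> a b; rewrite /d phiM -(dI_P a) -(dI_P b).
  have aE : a = P a + phi a *: e by rewrite subrK.
  have bE : b = P b + phi b *: e by rewrite subrK.
  have abE : a ** b = P a ** P b + phi b *: (P a ** e) +
      phi a *: (e ** P b) + (phi a * phi b) *: (e ** e).
    rewrite {1}aE {1}bE; move: (P a) (P b) (phi a) (phi b) => p q k l.
    by rewrite bmulDl !bmulDr !bmulZl !bmulZr scalerA addrA.
  have dIe : dI e = 0 by rewrite -dI_P /P phie scale1r subrr blin0.
  have dIee : dI (e ** e) = dI i by rewrite /i (blinB _ _ bdI) dIe subr0.
  have as_ : a *> s = P a *> delta e + phi a *: dI i.
    rewrite {1}aE lactDl lactZl /s (lactB (P a) (delta e) t).
    by rewrite (lactB e (delta e) t) t_Z// subr0 e_t /t subKr.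
  have adI : a *> dI (P b) = P a *> delta (P b) + phi a *: (e *> dI (P b)).
    by rewrite {1}aE lactDl lactZl dI_delta.
  have dIab : dI (a ** b) = P a *> delta (P b) +
      phi b *: (dI (P a) + P a *> delta e) + phi a *: (e *> dI (P b)) +
      (phi a * phi b) *: dI i.
    rewrite abE -dIM// -dI_r// -dI_l// -dIee.
    move: (P a) (P b) => p q; by rewrite !(blinD _ _ bdI) !(blinZ _ _ bdI).
  rewrite dIab lactDr lactZr as_ adI.
  apply: dual_separates => f.
  rewrite !(blinD _ _ (bf f), blinZ _ _ (bf f)).
  by rewrite /GRing.scale /=; ring.
- have tauE b : delta b - d b = kap (P b) + phi b *: t.
    rewrite /d /kap dI_P /P (blinB _ _ bdelta) (blinZ _ _ bdelta) /s scalerBr.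
    by apply: dual_separates => f; rewrite ?(raddfB f, raddfD f); ring.
  move=> a b; rewrite tauE.
  have tau_Z c : phi c = 0 -> c *> (kap (P b) + phi b *: t) = 0.
    by move=> pc; rewrite lactDr lactZr kap_Z// t_Z// scaler0 addr0.
  have aE : a = P a + phi a *: e by rewrite subrK.
  rewrite {1}aE lactDl tau_Z// add0r lactZl lactDr lactZr e_kap// e_t //.
Qed.

End lie_derivation_right_scalar.

(** * Bundled maps, and the two cases of the theorem *)

(** Continuity of the character is read off the module: [|phi a| * |x|] is the norm of [x <* a], and
    the action is bounded. *)
Lemma bounded_character (R : realType) (U : banachAlgType R)
    (X : banachBimodType U) (phi : {linear U -> R[i]^o}) (x : X) : x != 0 ->
  (forall a (y : X), y <* a = phi a *: y) -> bounded_linear phi.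
Proof.
move=> x0 hX; have [M M0 XM] := ract_boundedP (X := X).
have nx0 : 0 < `|x| by rewrite normr_gt0.
split; first exact: linearP.
exists M => // a; rewrite -(ler_pM2r nx0) -normrZ -hX.
by rewrite mulrAC XM.
Qed.

Lemma lie_derivation_right_scalar (R : realType) (U : banachAlgType R)
    (hU : amenable U) (phi : {linear U -> R[i]^o}) (hphi : character phi)
    (X : banachBimodType U) (hX : forall (a : U) (x : X), x <* a = phi a *: x)
    (delta : {linear U -> X}) :
  continuous delta -> lie_derivation delta ->
  exists d tau : {linear U -> X},
    [/\ continuous d, derivation d,
        continuous tau, center_valued_trace tau &
        forall a, delta a = d a + tau a].
Proof.
move=> cdelta ldelta.
(* The zero module is treated apart, because [bounded_character] needs a nonzero vector; there all
   equations are trivial. *)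
have [X0|/existsNP[x /eqP x0]] := pselect (forall x : X, x = 0).
  exists delta, delta; split=> // [a b||a]; last by rewrite [LHS]X0 [RHS]X0.
    by rewrite [LHS]X0 [RHS]X0.
  by split=> [a b|a b]; rewrite [LHS]X0 [RHS]X0.
have bphi := bounded_character x0 hX.
have [[a0 phia0] phiM] := hphi.
pose e := (phi a0)^-1 *: a0.
have phie : phi e = 1 by rewrite linearZ; exact: mulVf.
have [E [dE Ephi Er El]] := amenable_kernel_unit hU bphi phiM phie.
have bdelta : bounded_linear delta by apply/bounded_linearP.
have lie a b : delta (a ** b - b ** a) =
    (a *> delta b - phi a *: delta b) - (b *> delta a - phi b *: delta a).
  by rewrite opprB [RHS]addrC -!hX; exact: ldelta.
have [d0 [bd0 d0M d0Z]] :=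
  lie_derivation_right_scalar_decomp bphi phiM phie bdelta lie dE Ephi Er El.
have [d cd dE0] := blinP bd0.
have [tau ctau tauE] := blinP (bounded_linearD bdelta (bounded_linearN bd0)).
exists d, tau; split=> //.
- by move=> a b; rewrite hX -!dE0 d0M.
- split=> [a b|a b]; first by rewrite hX -tauE d0Z.
  have lactB c (y z : X) : c *> (y - z) = c *> y - c *> z.
    exact: blinB (bounded_linear_lact c).
  (* Centrality gives [c *> delta u - phi c *: delta u] the same value for [d0] in place of [delta],
     so both maps agree on commutators. *)
  have Z c u : c *> delta u = phi c *: (delta u - d0 u) + c *> d0 u.
    by rewrite -d0Z lactB subrK.
  rewrite -tauE /commAA lie (blinB _ _ bd0) !d0M !Z.
  apply: dual_separates => f; have bf := bounded_linear_of_dual f.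
  rewrite !(blinB _ _ bf, blinD _ _ bf, blinZ _ _ bf) raddf0.
  by rewrite /GRing.scale /=; ring.
- by move=> a; rewrite -dE0 -tauE addrC subrK.
Qed.

Theorem corollary5p3 (R : realType) (U : banachAlgType R) (hU : amenable U)
    (phi : {linear U -> R[i]^o}) (hphi : character phi)
    (X : banachBimodType U)
    (hX : (forall (a : U) (x : X), x <* a = phi a *: x) \/
          (forall (a : U) (x : X), a *> x = phi a *: x))
    (delta : {linear U -> X}) (cdelta : continuous delta)
    (hdelta : lie_derivation delta) :
  exists d tau : {linear U -> X},
    [/\ continuous d, derivation d,
        continuous tau, center_valued_trace tau &
        forall a, delta a = d a + tau a].
Proof.
case: hX => hX.
  exact: (lie_derivation_right_scalar hU hphi hX cdelta hdelta).
(* Over [opposite U] the left action on [X] becomes the right action on [Y], so the first case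
   applies. *)
pose theta : opposite U -> U := id.
have btheta : bounded_linear theta := bounded_linear_id U.
have thetaM a b : theta (a ** b) = theta b ** theta a by [].
pose Y := antipullback btheta thetaM X.
pose phi' : {linear opposite U -> R[i]^o} := phi.
have hphi' : character phi'.
  by have [phi0 phiM] := hphi; split=> // a b; rewrite mulrC; exact: phiM.
pose delta' : {linear opposite U -> Y} := delta.
(* The commutator of [a] and [b] in [opposite U] is that of [b] and [a] in [U], so the given
   identity is used with its arguments exchanged. *)
have ldelta' : lie_derivation delta'.
  move=> a b; have DE := hdelta b a; rewrite /commXA /commAX in DE *.
  by apply: etrans DE _; rewrite addrC.
have [d [tau [cd dd ctau [tauZ tauT] dtE]]] :=
  lie_derivation_right_scalar (amenable_opposite hU) hphi'
    (hX : forall a (x : Y), x <* a = phi' a *: x) cdelta ldelta'.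
exists d, tau; split=> //.
- by move=> a b; have DE := dd b a; apply: etrans DE _; rewrite addrC.
- split=> [a b|a b]; first exact: esym (tauZ a b).
  exact: tauT b a.
Qed.
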